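(* Let $(\mathcal{C},D,\theta)$ be a locally finite abelian ribbon r-category with braiding $c$, and let $(A,\mu_A,\iota_A)$ be a commutative algebra in $\mathcal{C}$ such that $\theta_A^2=\mathrm{id}_A$ and the unit morphism $\iota_A:\mathbf{1}\to A$ is injective. Also assume the following: (a) $\mathcal{C}_A^{\mathrm{loc}}$ is rigid and every simple object of $\mathcal{C}_A$ is an object of $\mathcal{C}_A^{\mathrm{loc}}$. (b) For any simple object $X\in\mathcal{C}$, the map $e_X:DX\otimes X\to\mathbf{1}$ is surjective and any non-zero $\mathcal{C}_A$-morphism from $F_A(DX)$ to $F_A(X)^*$ is an isomorphism. (c) For any $\mathcal{C}$-subobject $s:S\hookrightarrow A$ such that $S$ is not contained in $\mathrm{Im}\,\iota_A$, there exists an object $Z\in\mathcal{C}$ such that $c_{Z,S}\neq c_{S,Z}^{-1}$ and the map $s\otimes\mathrm{id}_Z:S\otimes Z\to A\otimes Z$ is injective. Then $\mathcal{C}$ is rigid.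
   Context: Associativity and unit isomorphisms are suppressed; $\mathbb{K}$ is a field. A locally finite abelian category is a $\mathbb{K}$-linear abelian category with finite-dimensional morphism spaces and finite-length objects; tensor products are assumed $\mathbb{K}$-bilinear. An object $K$ of a monoidal category $\mathcal{C}$ is dualizing if for every $X\in\mathcal{C}$ the functor $\mathrm{Hom}_{\mathcal{C}}(-\otimes X,K)$ is representable and the resulting contravariant functor $D$ is an anti-equivalence. Representability means that there are an object $DX$ and a morphism $e_X:DX\otimes X\to K$ such that for every $f:Y\otimes X\to K$ there is a unique $\varphi:Y\to DX$ with $e_X\circ(\varphi\otimes\mathrm{id}_X)=f$. On $f:X\to Y$, $Df:DY\to DX$ is the unique morphism with $e_X\circ(Df\otimes\mathrm{id}_X)=e_Y\circ(\mathrm{id}_{DY}\otimes f)$. An r-category is a monoidal category for which the unit object $\mathbf{1}$ is dualizing (we take $K=\mathbf{1}$). A ribbon r-category $(\mathcal{C},D,\theta)$ is a braided r-category with dualizing functor $D$ and a twist, i.e. a natural isomorphism $\theta:\mathrm{id}_{\mathcal{C}}\to\mathrm{id}_{\mathcal{C}}$ with $\theta_{X\otimes Y}=c_{Y,X}\circ c_{X,Y}\circ(\theta_X\otimes\theta_Y)$, such that $D\theta_X=\theta_{DX}$ for all $X$. A monoidal category is rigid if every object has a left and a right dual. An algebra $(A,\mu_A,\iota_A)$ is commutative if $\mu_A\circ c_{A,A}=\mu_A$. The category $\mathcal{C}_A$ of left $A$-modules $(M,\mu_M)$ is monoidal with unit $A$: $M\otimes_A N$ is the coequalizer, with projection $\pi_{M,N}:M\otimes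 N\to M\otimes_A N$, of $\mu_M\otimes\mathrm{id}_N$ and $(\mathrm{id}_M\otimes\mu_N)\circ(c_{A,M}\otimes\mathrm{id}_N)$ from $A\otimes M\otimes N$ to $M\otimes N$, with action determined by $\mu_{M\otimes_A N}\circ(\mathrm{id}_A\otimes\pi_{M,N})=\pi_{M,N}\circ(\mu_M\otimes\mathrm{id}_N)$. $\mathcal{C}_A^{\mathrm{loc}}\subseteq\mathcal{C}_A$ is the full monoidal subcategory of local modules, those with $\mu_M\circ c_{M,A}\circ c_{A,M}=\mu_M$. The induction functor $F_A:\mathcal{C}\to\mathcal{C}_A$ is $F_A(X)=(A\otimes X,\mu_A\otimes\mathrm{id}_X)$, $F_A(f)=\mathrm{id}_A\otimes f$. $F_A(X)^*$ denotes the left dual of $F_A(X)$ in $\mathcal{C}_A$ (the category $\mathcal{C}_A$ is rigid under the assumption $\theta_A^2=\mathrm{id}_A$ and (a), so this dual exists). ''$S$ is not contained in $\mathrm{Im}\,\iota_A$'' means that $s\neq\iota_A\circ f$ for every $f\in\mathrm{Hom}_{\mathcal{C}}(S,\mathbf{1})$. *)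

(* Defs.v *)
From HB Require Import structures.
From mathcomp Require Import all_boot all_algebra.

Set Implicit Arguments.
Unset Strict Implicit.
Unset Printing Implicit Defensive.

Import GRing.Theory.
Local Open Scope ring_scope.

Declare Scope cat_scope.
Delimit Scope cat_scope with cat.
Global Open Scope cat_scope.

(** [vectType K] is the type of finite-dimensional vector spaces, so that all
    categories below are K-linear with finite-dimensional morphism spaces. *)
Record lincat (K : fieldType) := LinCat {
  Ob :> Type;
  Mor : Ob -> Ob -> vectType K;
  idm : forall X, Mor X X;
  mcomp : forall X Y Z, Mor Y Z -> Mor X Y -> Mor X Z;
  comp1m : forall X Y (f : Mor X Y), mcomp (idm Y) f = f;
  compm1 : forall X Y (f : Mor X Y), mcomp f (idm X) = f;
  compA : forall X Y Z W (h : Mor Z W) (g : Mor Y Z) (f : Mor X Y),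
    mcomp h (mcomp g f) = mcomp (mcomp h g) f;
  compPr : forall X Y Z (a : K) (g : Mor Y Z) (f1 f2 : Mor X Y),
    mcomp g (a *: f1 + f2) = a *: mcomp g f1 + mcomp g f2;
  compPl : forall X Y Z (a : K) (g1 g2 : Mor Y Z) (f : Mor X Y),
    mcomp (a *: g1 + g2) f = a *: mcomp g1 f + mcomp g2 f }.

Arguments Mor {K C} : rename.
Arguments idm {K C} X : rename.
Arguments mcomp {K C X Y Z} g f : rename.

Notation "g ∘ f" := (mcomp g f) (at level 47, right associativity) : cat_scope.

Section CatBasics.
Variables (K : fieldType) (C : lincat K).
Implicit Types X Y Z W : C.

Definition mono X Y (f : Mor X Y) : Prop :=
  forall W (g h : Mor W X), f ∘ g = f ∘ h -> g = h.

Definition epi X Y (f : Mor X Y) : Prop :=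
  forall W (g h : Mor Y W), g ∘ f = h ∘ f -> g = h.

Definition inverse_of X Y (f : Mor X Y) (g : Mor Y X) : Prop :=
  g ∘ f = idm X /\ f ∘ g = idm Y.

Definition iso X Y (f : Mor X Y) : Prop := exists g, inverse_of f g.

Definition zero_object X : Prop :=
  (forall Y, exists! f : Mor X Y, True) /\ (forall Y, exists! f : Mor Y X, True).

Definition simple X : Prop :=
  ~ zero_object X /\
  forall S (s : Mor S X), mono s -> zero_object S \/ iso s.

Definition is_kernel N X Y (k : Mor N X) (f : Mor X Y) : Prop :=
  f ∘ k = 0 /\
  forall W (g : Mor W X), f ∘ g = 0 -> exists! h : Mor W N, k ∘ h = g.

Definition is_cokernel X Y Q (f : Mor X Y) (q : Mor Y Q) : Prop :=
  q ∘ f = 0 /\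
  forall W (g : Mor Y W), g ∘ f = 0 -> exists! h : Mor Q W, h ∘ q = g.

Lemma compm0 X Y Z (g : Mor Y Z) : g ∘ (0 : Mor X Y) = 0.
Proof.
have := compPr 1 g (0 : Mor X Y) 0; rewrite scaler0 addr0 scale1r.
by move/(congr1 (fun u => u - g ∘ (0 : Mor X Y))); rewrite addrK subrr.
Qed.

Lemma comp0m X Y Z (f : Mor X Y) : (0 : Mor Y Z) ∘ f = 0.
Proof.
have := compPl 1 (0 : Mor Y Z) 0 f; rewrite scaler0 addr0 scale1r.
by move/(congr1 (fun u => u - (0 : Mor Y Z) ∘ f)); rewrite addrK subrr.
Qed.

Lemma compBr X Y Z (g : Mor Y Z) (f1 f2 : Mor X Y) :
  g ∘ (f1 - f2) = (g ∘ f1) - (g ∘ f2).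
Proof. by rewrite -[f1 - f2]addrC -scaleN1r compPr scaleN1r addrC. Qed.

Lemma compBl X Y Z (g1 g2 : Mor Y Z) (f : Mor X Y) :
  (g1 - g2) ∘ f = (g1 ∘ f) - (g2 ∘ f).
Proof. by rewrite -[g1 - g2]addrC -scaleN1r compPl scaleN1r addrC. Qed.

Lemma compr1 X Y Z (g : Mor Y Z) (f : Mor X Y) (k : Mor X Z) :
  g ∘ f = k -> forall W (x : Mor W X), g ∘ f ∘ x = k ∘ x.
Proof. by move=> <- W x; rewrite compA. Qed.

Lemma compr2 X Y Y' Z (g : Mor Y Z) (f : Mor X Y) (k : Mor Y' Z) (l : Mor X Y') :
  g ∘ f = k ∘ l -> forall W (x : Mor W X), g ∘ f ∘ x = k ∘ l ∘ x.
Proof. by move=> e W x; rewrite compA e compA. Qed.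

Lemma compr23 X Y Y1 Y2 Z (g : Mor Y Z) (f : Mor X Y)
    (k : Mor Y2 Z) (l : Mor Y1 Y2) (m : Mor X Y1) :
  g ∘ f = k ∘ l ∘ m -> forall W (x : Mor W X), g ∘ f ∘ x = k ∘ l ∘ m ∘ x.
Proof. by move=> e W x; rewrite compA e -!compA. Qed.

Lemma compr3 X Y1 Y2 Y3 Z (h : Mor Y3 Z) (g : Mor Y2 Y3) (f : Mor X Y2)
    (k : Mor Y1 Z) (l : Mor X Y1) :
  h ∘ g ∘ f = k ∘ l -> forall W (x : Mor W X), h ∘ g ∘ f ∘ x = k ∘ l ∘ x.
Proof. by move=> e W x; rewrite (compA g) (compA h) e -!compA. Qed.

Lemma comprK X Y (g : Mor Y X) (f : Mor X Y) :
  g ∘ f = idm X -> forall W (x : Mor W X), g ∘ f ∘ x = x.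
Proof. by move=> e W x; rewrite compA e comp1m. Qed.

Lemma epi_comp X Y Z (g : Mor Y Z) (f : Mor X Y) : epi g -> epi f -> epi (g ∘ f).
Proof. by move=> eg ef W h k; rewrite !compA => /ef /eg. Qed.

Lemma epi_inv X Y (f : Mor X Y) (g : Mor Y X) : f ∘ g = idm Y -> epi f.
Proof.
move=> fg W h k /(congr1 (fun u => u ∘ g)).
by rewrite -!compA fg !compm1.
Qed.

Lemma epi_fact X Y Z W (g : Mor Y Z) (f : Mor X Y) (k : Mor W Z) (l : Mor X W) :
  k ∘ l = g ∘ f -> epi g -> epi f -> epi k.
Proof.
move=> e eg ef V h h' /(congr1 (fun u => u ∘ l)); rewrite -!compA e.
exact: (epi_comp eg ef).
Qed.

End CatBasics.

Definition opcat (K : fieldType) (C : lincat K) : lincat K :=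
  @LinCat K C (fun X Y => Mor Y X) (@idm K C) (fun X Y Z g f => f ∘ g)
    (fun X Y f => compm1 f) (fun X Y f => comp1m f)
    (fun X Y Z W h g f => esym (compA f g h))
    (fun X Y Z a g f1 f2 => compPl a f1 f2 g)
    (fun X Y Z a g1 g2 f => compPr a f g1 g2).

Record functor (K : fieldType) (C C' : lincat K) := Functor {
  fob :> C -> C';
  fmor : forall X Y, Mor X Y -> Mor (fob X) (fob Y);
  fmor1 : forall X, fmor (idm X) = idm (fob X);
  fmorM : forall X Y Z (g : Mor Y Z) (f : Mor X Y),
    fmor (g ∘ f) = fmor g ∘ fmor f }.

Arguments fmor {K C C'} F {X Y} f : rename.

Section Functors.
Variable K : fieldType.

Definition idfun_cat (C : lincat K) : functor C C :=
  @Functor K C C id (fun _ _ f => f) (fun=> erefl) (fun _ _ _ _ _ => erefl).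

Lemma compfun1 (C C' C'' : lincat K) (G : functor C' C'') (F : functor C C') X :
  fmor G (fmor F (idm X)) = idm (G (F X)).
Proof. by rewrite !fmor1. Qed.

Lemma compfunM (C C' C'' : lincat K) (G : functor C' C'') (F : functor C C')
    (X Y Z : C) (g : Mor Y Z) (f : Mor X Y) :
  fmor G (fmor F (g ∘ f)) = fmor G (fmor F g) ∘ fmor G (fmor F f).
Proof. by rewrite !fmorM. Qed.

Definition compfun (C C' C'' : lincat K) (G : functor C' C'') (F : functor C C') :
    functor C C'' :=
  @Functor K C C'' (fun X => G (F X)) (fun X Y f => fmor G (fmor F f))
    (compfun1 G F) (@compfunM C C' C'' G F).

Definition natural_iso (C C' : lincat K) (F G : functor C C')
    (u : forall X, Mor (F X) (G X)) : Prop :=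
  (forall X, iso (u X)) /\
  forall X Y (f : Mor X Y), u Y ∘ fmor F f = fmor G f ∘ u X.

Definition equivalence (C C' : lincat K) (F : functor C C') : Prop :=
  exists G : functor C' C,
    (exists u, natural_iso (F := compfun G F) (G := idfun_cat C) u) /\
    (exists v, natural_iso (F := compfun F G) (G := idfun_cat C') v).

End Functors.

Record abelian (K : fieldType) (C : lincat K) := Abelian {
  zero_ob : C;
  zero_obP : zero_object zero_ob;
  biprod : C -> C -> C;
  bin1 : forall X Y, Mor X (biprod X Y);
  bin2 : forall X Y, Mor Y (biprod X Y);
  bpr1 : forall X Y, Mor (biprod X Y) X;
  bpr2 : forall X Y, Mor (biprod X Y) Y;
  bpr1_in1 : forall X Y, bpr1 X Y ∘ bin1 X Y = idm X;
  bpr2_in2 : forall X Y, bpr2 X Y ∘ bin2 X Y = idm Y;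
  bin_pr : forall X Y,
    (bin1 X Y ∘ bpr1 X Y) + (bin2 X Y ∘ bpr2 X Y) = idm (biprod X Y);
  ker : forall X Y, Mor X Y -> C;
  kerm : forall X Y (f : Mor X Y), Mor (ker f) X;
  kermP : forall X Y (f : Mor X Y), is_kernel (kerm f) f;
  coker : forall X Y, Mor X Y -> C;
  cokerm : forall X Y (f : Mor X Y), Mor Y (coker f);
  cokermP : forall X Y (f : Mor X Y), is_cokernel f (cokerm f);
  mono_normal : forall X Y (f : Mor X Y), mono f ->
    exists (Z : C) (g : Mor Y Z), is_kernel f g;
  epi_normal : forall X Y (f : Mor X Y), epi f ->
    exists (Z : C) (g : Mor Z X), is_cokernel g f }.

Arguments coker {K C} a {X Y} f : rename.
Arguments cokerm {K C} a {X Y} f : rename.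

Section FiniteLength.
Variables (K : fieldType) (C : lincat K) (ab : abelian C).

(** A composition series, built by adjoining one simple quotient at a time. *)
Inductive finite_length : C -> Prop :=
| finite_length0 X : zero_object X -> finite_length X
| finite_lengthS X Y (i : Mor Y X) :
    finite_length Y -> mono i -> simple (coker ab i) -> finite_length X.

End FiniteLength.

Record moncat (K : fieldType) := MonCat {
  mcat :> lincat K;
  munit : mcat;
  tens : mcat -> mcat -> mcat;
  tensm : forall X X' Y Y' : mcat,
    Mor X X' -> Mor Y Y' -> Mor (tens X Y) (tens X' Y');
  tensm1 : forall X Y, tensm (idm X) (idm Y) = idm (tens X Y);
  tensmM : forall X X' X'' Y Y' Y''
    (f' : Mor X' X'') (f : Mor X X') (g' : Mor Y' Y'') (g : Mor Y Y'),
    tensm (f' ∘ f) (g' ∘ g) = tensm f' g' ∘ tensm f g;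
  tensmPl : forall X X' Y Y' (a : K) (f1 f2 : Mor X X') (g : Mor Y Y'),
    tensm (a *: f1 + f2) g = a *: tensm f1 g + tensm f2 g;
  tensmPr : forall X X' Y Y' (a : K) (f : Mor X X') (g1 g2 : Mor Y Y'),
    tensm f (a *: g1 + g2) = a *: tensm f g1 + tensm f g2;
  asc : forall X Y Z, Mor (tens (tens X Y) Z) (tens X (tens Y Z));
  asci : forall X Y Z, Mor (tens X (tens Y Z)) (tens (tens X Y) Z);
  ascP : forall X Y Z, inverse_of (asc X Y Z) (asci X Y Z);
  asc_nat : forall X X' Y Y' Z Z' (f : Mor X X') (g : Mor Y Y') (h : Mor Z Z'),
    asc X' Y' Z' ∘ tensm (tensm f g) h = tensm f (tensm g h) ∘ asc X Y Z;
  lun : forall X, Mor (tens munit X) X;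
  luni : forall X, Mor X (tens munit X);
  lunP : forall X, inverse_of (lun X) (luni X);
  lun_nat : forall X Y (f : Mor X Y), lun Y ∘ tensm (idm munit) f = f ∘ lun X;
  run : forall X, Mor (tens X munit) X;
  runi : forall X, Mor X (tens X munit);
  runP : forall X, inverse_of (run X) (runi X);
  run_nat : forall X Y (f : Mor X Y), run Y ∘ tensm f (idm munit) = f ∘ run X;
  pentagon : forall X Y Z W,
    tensm (idm X) (asc Y Z W) ∘ asc X (tens Y Z) W ∘ tensm (asc X Y Z) (idm W)
    = asc X Y (tens Z W) ∘ asc (tens X Y) Z W;
  triangle : forall X Y,
    tensm (idm X) (lun Y) ∘ asc X munit Y = tensm (run X) (idm Y) }.

Arguments munit {K} C : rename.
Arguments tens {K C} X Y : rename.
Arguments tensm {K C X X' Y Y'} f g : rename.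
Arguments asc {K C} X Y Z : rename.
Arguments asci {K C} X Y Z : rename.
Arguments lun {K C} X : rename.
Arguments luni {K C} X : rename.
Arguments run {K C} X : rename.
Arguments runi {K C} X : rename.

Notation "X ⊗ Y" := (tens X Y) (at level 39, left associativity) : cat_scope.
Notation "f ⊗ₘ g" := (tensm f g) (at level 39, left associativity) : cat_scope.

Section Rigidity.
Variables (K : fieldType) (C : moncat K).

(** [Y] is a left dual of [X], with evaluation [Y ⊗ X -> 1] and coevaluation
    [1 -> X ⊗ Y]. *)
Definition duality (X Y : C) (ev : Mor (Y ⊗ X) (munit C))
    (coev : Mor (munit C) (X ⊗ Y)) : Prop :=
  run X ∘ (idm X ⊗ₘ ev) ∘ asc X Y X ∘ (coev ⊗ₘ idm X) ∘ luni X = idm X /\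
  lun Y ∘ (ev ⊗ₘ idm Y) ∘ asci Y X Y ∘ (idm Y ⊗ₘ coev) ∘ runi Y = idm Y.

Definition left_dual (X Y : C) : Prop := exists ev coev, @duality X Y ev coev.
Definition right_dual (X Y : C) : Prop := left_dual Y X.

Definition rigid : Prop :=
  forall X : C, (exists Y, left_dual X Y) /\ (exists Y, right_dual X Y).

End Rigidity.

Section FullSub.
Variables (K : fieldType) (C : moncat K) (P : C -> Prop).
Hypothesis P1 : P (munit C).
Hypothesis Ptens : forall X Y, P X -> P Y -> P (X ⊗ Y).

Definition fullsub : lincat K :=
  @LinCat K {X : C | P X} (fun X Y => Mor (sval X) (sval Y))
    (fun X => idm (sval X)) (fun X Y Z g f => g ∘ f)
    (fun X Y f => comp1m f) (fun X Y f => compm1 f)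
    (fun X Y Z W h g f => compA h g f)
    (fun X Y Z a g f1 f2 => compPr a g f1 f2)
    (fun X Y Z a g1 g2 f => compPl a g1 g2 f).

Definition fullsub_moncat : moncat K :=
  @MonCat K fullsub (exist P (munit C) P1)
    (fun X Y => exist P (sval X ⊗ sval Y) (Ptens (svalP X) (svalP Y)))
    (fun X X' Y Y' f g => f ⊗ₘ g)
    (fun X Y => tensm1 (sval X) (sval Y))
    (fun X X' X'' Y Y' Y'' f' f g' g => tensmM f' f g' g)
    (fun X X' Y Y' a f1 f2 g => tensmPl a f1 f2 g)
    (fun X X' Y Y' a f g1 g2 => tensmPr a f g1 g2)
    (fun X Y Z => asc (sval X) (sval Y) (sval Z))
    (fun X Y Z => asci (sval X) (sval Y) (sval Z))
    (fun X Y Z => ascP (sval X) (sval Y) (sval Z))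
    (fun X X' Y Y' Z Z' f g h => asc_nat f g h)
    (fun X => lun (sval X)) (fun X => luni (sval X)) (fun X => lunP (sval X))
    (fun X Y f => lun_nat f)
    (fun X => run (sval X)) (fun X => runi (sval X)) (fun X => runP (sval X))
    (fun X Y f => run_nat f)
    (fun X Y Z W => pentagon (sval X) (sval Y) (sval Z) (sval W))
    (fun X Y => triangle (sval X) (sval Y)).

End FullSub.

Record braiding (K : fieldType) (C : moncat K) := Braiding {
  br :> forall X Y : C, Mor (X ⊗ Y) (Y ⊗ X);
  bri : forall X Y : C, Mor (Y ⊗ X) (X ⊗ Y);
  brP : forall X Y, inverse_of (br X Y) (bri X Y);
  br_nat : forall X X' Y Y' (f : Mor X X') (g : Mor Y Y'),
    br X' Y' ∘ (f ⊗ₘ g) = (g ⊗ₘ f) ∘ br X Y;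
  br_hexr : forall X Y Z,
    asc Y Z X ∘ br X (Y ⊗ Z) ∘ asc X Y Z
    = (idm Y ⊗ₘ br X Z) ∘ asc Y X Z ∘ (br X Y ⊗ₘ idm Z);
  br_hexl : forall X Y Z,
    asci Z X Y ∘ br (X ⊗ Y) Z ∘ asci X Y Z
    = (br X Z ⊗ₘ idm Y) ∘ asci X Z Y ∘ (idm X ⊗ₘ br Y Z) }.

Arguments bri {K C} c X Y : rename.

Section Dualizing.
Variables (K : fieldType) (C : moncat K) (k : C).

Record dual_data := DualData {
  dob : C -> C;
  dev : forall X, Mor (dob X ⊗ X) k;
  dev_univ : forall X Y (f : Mor (Y ⊗ X) k),
    exists! phi : Mor Y (dob X), dev X ∘ (phi ⊗ₘ idm X) = f }.

Variable R : dual_data.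

Lemma dfact_ex X Y (f : Mor (Y ⊗ X) k) :
  exists phi : Mor Y (dob R X), dev R X ∘ (phi ⊗ₘ idm X) == f.
Proof. by have [phi [/eqP h _]] := dev_univ R f; exists phi. Qed.

Definition dfact X Y (f : Mor (Y ⊗ X) k) : Mor Y (dob R X) := xchoose (dfact_ex f).

Lemma dfactK X Y (f : Mor (Y ⊗ X) k) : dev R X ∘ (dfact f ⊗ₘ idm X) = f.
Proof. exact/eqP/(xchooseP (dfact_ex f)). Qed.

Lemma dev_inj X Y (phi psi : Mor Y (dob R X)) :
  dev R X ∘ (phi ⊗ₘ idm X) = dev R X ∘ (psi ⊗ₘ idm X) -> phi = psi.
Proof.
have [chi [_ u]] := dev_univ R (dev R X ∘ (phi ⊗ₘ idm X)).
by move=> e; rewrite -(u _ erefl) -(u _ (esym e)).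
Qed.

Definition dmor X Y (f : Mor X Y) : Mor (dob R Y) (dob R X) :=
  dfact (dev R Y ∘ (idm (dob R Y) ⊗ₘ f)).

Lemma dmorE X Y (f : Mor X Y) :
  dev R X ∘ (dmor f ⊗ₘ idm X) = dev R Y ∘ (idm (dob R Y) ⊗ₘ f).
Proof. exact: dfactK. Qed.

Lemma dmor1 (X : opcat C) : dmor (idm X) = idm (dob R X).
Proof. by apply: dev_inj; rewrite dmorE. Qed.

Lemma dmorM (X Y Z : opcat C) (g : Mor Y Z) (f : Mor X Y) :
  dmor (g ∘ f) = dmor g ∘ dmor f.
Proof.
apply: dev_inj; rewrite dmorE /=.
rewrite -[in RHS](comp1m (idm Z)) tensmM compA dmorE -compA -tensmM.
rewrite comp1m compm1 -[RHS]/(dev R Y ∘ (dmor f ⊗ₘ g)).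
rewrite -[dmor f in RHS]comp1m -[g in RHS]comp1m.
rewrite -[in LHS](comp1m (idm (dob R X))) tensmM compA -dmorE -compA -tensmM.
by rewrite !comp1m compm1.
Qed.

Definition dfun : functor (opcat C) C :=
  @Functor K (opcat C) C (dob R) (fun X Y f => dmor f) dmor1 dmorM.

End Dualizing.

Record dualizing (K : fieldType) (C : moncat K) (k : C) := Dualizing {
  ddata :> dual_data k;
  dfun_equiv : equivalence (dfun ddata) }.

Definition r_structure (K : fieldType) (C : moncat K) := dualizing (munit C).

Record twist (K : fieldType) (C : moncat K) (c : braiding C) := Twist {
  tw :> forall X : C, Mor X X;
  tw_nat_iso : natural_iso (F := idfun_cat C) (G := idfun_cat C) tw;
  tw_tens : forall X Y,
    tw (X ⊗ Y) = c Y X ∘ c X Y ∘ (tw X ⊗ₘ tw Y) }.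

Definition ribbon (K : fieldType) (C : moncat K) (c : braiding C)
    (D : r_structure C) (theta : twist c) : Prop :=
  forall X : C, dmor D (theta X) = theta (dob D X).

Section MonBasics.
Variables (K : fieldType) (C : moncat K).
Implicit Types X Y Z W : C.

Lemma ascK X Y Z : asci X Y Z ∘ asc X Y Z = idm (X ⊗ Y ⊗ Z).
Proof. by case: (ascP X Y Z). Qed.
Lemma asciK X Y Z : asc X Y Z ∘ asci X Y Z = idm (X ⊗ (Y ⊗ Z)).
Proof. by case: (ascP X Y Z). Qed.
Lemma lunK X : luni X ∘ lun X = idm (munit C ⊗ X).
Proof. by case: (lunP X). Qed.
Lemma luniK X : lun X ∘ luni X = idm X.
Proof. by case: (lunP X). Qed.
Lemma runK X : runi X ∘ run X = idm (X ⊗ munit C).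
Proof. by case: (runP X). Qed.
Lemma runiK X : run X ∘ runi X = idm X.
Proof. by case: (runP X). Qed.

Lemma asci_nat X X' Y Y' Z Z' (f : Mor X X') (g : Mor Y Y') (h : Mor Z Z') :
  (f ⊗ₘ g ⊗ₘ h) ∘ asci X Y Z = asci X' Y' Z' ∘ (f ⊗ₘ (g ⊗ₘ h)).
Proof.
rewrite -[LHS]comp1m -ascK -!compA (compr2 (asc_nat f g h)) asciK.
by rewrite compm1.
Qed.

Lemma luni_nat X Y (f : Mor X Y) : luni Y ∘ f = (idm (munit C) ⊗ₘ f) ∘ luni X.
Proof.
by rewrite -[RHS]comp1m -lunK -!compA (compr2 (lun_nat f)) luniK compm1.
Qed.

Lemma runi_nat X Y (f : Mor X Y) : runi Y ∘ f = (f ⊗ₘ idm (munit C)) ∘ runi X.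
Proof.
by rewrite -[RHS]comp1m -runK -!compA (compr2 (run_nat f)) runiK compm1.
Qed.

Lemma whl X Y Z W (g : Mor Y Z) (f : Mor X Y) :
  (idm W ⊗ₘ g) ∘ (idm W ⊗ₘ f) = idm W ⊗ₘ (g ∘ f).
Proof. by rewrite -tensmM comp1m. Qed.

Lemma whr X Y Z W (g : Mor Y Z) (f : Mor X Y) :
  (g ⊗ₘ idm W) ∘ (f ⊗ₘ idm W) = (g ∘ f) ⊗ₘ idm W.
Proof. by rewrite -tensmM comp1m. Qed.

Lemma tlr X X' Y Y' (f : Mor X X') (g : Mor Y Y') :
  (f ⊗ₘ idm Y') ∘ (idm X ⊗ₘ g) = f ⊗ₘ g.
Proof. by rewrite -tensmM comp1m compm1. Qed.

Lemma trl X X' Y Y' (f : Mor X X') (g : Mor Y Y') :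
  (idm X' ⊗ₘ g) ∘ (f ⊗ₘ idm Y) = f ⊗ₘ g.
Proof. by rewrite -tensmM comp1m compm1. Qed.

Lemma xch X X' Y Y' (f : Mor X X') (g : Mor Y Y') :
  (f ⊗ₘ idm Y') ∘ (idm X ⊗ₘ g) = (idm X' ⊗ₘ g) ∘ (f ⊗ₘ idm Y).
Proof. by rewrite tlr trl. Qed.

Lemma tens0m X X' Y Y' (g : Mor Y Y') : (0 : Mor X X') ⊗ₘ g = 0.
Proof.
have := tensmPl 1 (0 : Mor X X') 0 g; rewrite scaler0 addr0 scale1r.
by move/(congr1 (fun u => u - (0 : Mor X X') ⊗ₘ g)); rewrite addrK subrr.
Qed.

Lemma tensm0 X X' Y Y' (f : Mor X X') : f ⊗ₘ (0 : Mor Y Y') = 0.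
Proof.
have := tensmPr 1 f (0 : Mor Y Y') 0; rewrite scaler0 addr0 scale1r.
by move/(congr1 (fun u => u - f ⊗ₘ (0 : Mor Y Y'))); rewrite addrK subrr.
Qed.

Lemma tensBm X X' Y Y' (f1 f2 : Mor X X') (g : Mor Y Y') :
  (f1 - f2) ⊗ₘ g = f1 ⊗ₘ g - f2 ⊗ₘ g.
Proof. by rewrite -[f1 - f2]addrC -scaleN1r tensmPl scaleN1r addrC. Qed.

Lemma tensmB X X' Y Y' (f : Mor X X') (g1 g2 : Mor Y Y') :
  f ⊗ₘ (g1 - g2) = f ⊗ₘ g1 - f ⊗ₘ g2.
Proof. by rewrite -[g1 - g2]addrC -scaleN1r tensmPr scaleN1r addrC. Qed.

Lemma asc_whl X Y Z Z' (h : Mor Z Z') :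
  asc X Y Z' ∘ (idm (X ⊗ Y) ⊗ₘ h) = (idm X ⊗ₘ (idm Y ⊗ₘ h)) ∘ asc X Y Z.
Proof. by rewrite -tensm1 asc_nat. Qed.

Lemma asc_whr X X' Y Z (f : Mor X X') :
  asc X' Y Z ∘ (f ⊗ₘ idm Y ⊗ₘ idm Z) = (f ⊗ₘ idm (Y ⊗ Z)) ∘ asc X Y Z.
Proof. by rewrite -tensm1 asc_nat. Qed.

Lemma asci_whl X Y Z Z' (h : Mor Z Z') :
  asci X Y Z' ∘ (idm X ⊗ₘ (idm Y ⊗ₘ h)) = (idm (X ⊗ Y) ⊗ₘ h) ∘ asci X Y Z.
Proof. by rewrite -tensm1 asci_nat. Qed.

Lemma asci_whr X X' Y Z (f : Mor X X') :
  asci X' Y Z ∘ (f ⊗ₘ idm (Y ⊗ Z)) = (f ⊗ₘ idm Y ⊗ₘ idm Z) ∘ asci X Y Z.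
Proof. by rewrite -tensm1 asci_nat. Qed.

Lemma pentB X Y Z W :
  asc X (Y ⊗ Z) W ∘ (asc X Y Z ⊗ₘ idm W)
  = (idm X ⊗ₘ asci Y Z W) ∘ asc X Y (Z ⊗ W) ∘ asc (X ⊗ Y) Z W.
Proof.
by rewrite -pentagon compA whl ascK tensm1 comp1m.
Qed.

Lemma pentD X Y Z W :
  asc (X ⊗ Y) Z W ∘ (asci X Y Z ⊗ₘ idm W)
  = asci X Y (Z ⊗ W) ∘ (idm X ⊗ₘ asc Y Z W) ∘ asc X (Y ⊗ Z) W.
Proof.
rewrite -[RHS]compm1 -tensm1 -asciK -whr -!compA (compr2 (pentB X Y Z W)).
rewrite -!compA (compr1 (whl _ _ _)) asciK tensm1 comp1m.
by rewrite (comprK (ascK _ _ _)).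
Qed.

Lemma pentE X Y Z W :
  (asc X Y Z ⊗ₘ idm W) ∘ asci (X ⊗ Y) Z W
  = asci X (Y ⊗ Z) W ∘ (idm X ⊗ₘ asci Y Z W) ∘ asc X Y (Z ⊗ W).
Proof.
rewrite -[LHS](comprK (ascK _ _ _)) (compr2 (pentB X Y Z W)).
by rewrite -!compA asciK compm1.
Qed.

Lemma pentF X Y Z W :
  asci (X ⊗ Y) Z W ∘ asci X Y (Z ⊗ W)
  = (asci X Y Z ⊗ₘ idm W) ∘ asci X (Y ⊗ Z) W ∘ (idm X ⊗ₘ asci Y Z W).
Proof.
have e := pentE X Y Z W.
rewrite -[LHS]comp1m -tensm1 -ascK -whr -!compA (compr2 e).
by rewrite -!compA asciK compm1.
Qed.

Lemma tens1_inj X Y (f g : Mor X Y) :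
  idm (munit C) ⊗ₘ f = idm (munit C) ⊗ₘ g -> f = g.
Proof.
move=> e; rewrite -[f]compm1 -luniK compA -lun_nat e lun_nat -compA luniK.
by rewrite compm1.
Qed.

Lemma tensr1_inj X Y (f g : Mor X Y) :
  f ⊗ₘ idm (munit C) = g ⊗ₘ idm (munit C) -> f = g.
Proof.
move=> e; rewrite -[f]compm1 -runiK compA -run_nat e run_nat -compA runiK.
by rewrite compm1.
Qed.

Lemma lun_asc X Y : lun (X ⊗ Y) ∘ asc (munit C) X Y = lun X ⊗ₘ idm Y.
Proof.
apply: tens1_inj; rewrite -whl.
have ep : epi (asc (munit C) (munit C ⊗ X) Y ∘ (asc (munit C) (munit C) X ⊗ₘ idm Y)).
  apply: epi_comp; first exact: epi_inv (asciK _ _ _).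
  by apply: (@epi_inv _ _ _ _ _ (asci _ _ X ⊗ₘ idm Y)); rewrite whr asciK tensm1.
apply: ep; rewrite -!compA pentagon (compr1 (triangle _ _)).
rewrite -asc_whr -triangle -whr.
by rewrite (compr2 (asc_nat _ _ _)).
Qed.

Lemma run_asc X Y : (idm X ⊗ₘ run Y) ∘ asc X Y (munit C) = run (X ⊗ Y).
Proof.
apply: tensr1_inj.
rewrite -triangle -whr.
have e := pentagon X Y (munit C) (munit C).
have : (idm X ⊗ₘ (idm Y ⊗ₘ lun (munit C))) ∘ asc X Y (munit C ⊗ munit C) ∘ asc (X ⊗ Y) (munit C) (munit C)
  = asc X Y (munit C) ∘ (idm (X ⊗ Y) ⊗ₘ lun (munit C)) ∘ asc (X ⊗ Y) (munit C) (munit C).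
  by rewrite (compr2 (asc_whl _ _ _)).
rewrite -e (compr1 (whl _ _ _)) triangle.
rewrite -(compr2 (asc_nat _ _ _)) => h.
by rewrite -[LHS](comprK (ascK X Y (munit C))) h (comprK (ascK _ _ _)).
Qed.

End MonBasics.

Section Exactness.
Variables (K : fieldType) (C : moncat K).

Lemma coker_epi (X Y Q : C) (f : Mor X Y) (q : Mor Y Q) : is_cokernel f q -> epi q.
Proof.
case=> q0 u W g h e; have [] := u W (g ∘ q); first by rewrite -compA q0 compm0.
by move=> k [_ uk]; rewrite -(uk g erefl) -(uk h).
Qed.

Lemma internal_hom (D : r_structure C) (X Z : C) :
  exists (H : C) (ep : Mor (H ⊗ X) Z), forall Y (g : Mor (Y ⊗ X) Z),
    exists! phi : Mor Y H, ep ∘ (phi ⊗ₘ idm X) = g.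
Proof.
have [G [_ [v [viso _]]]] := dfun_equiv D.
have [v' [v'v vv']] := viso Z.
pose W : C := G Z.
pose vZ : Mor (dob D W) Z := v Z; pose vZ' : Mor Z (dob D W) := v'.
have {}v'v : vZ' ∘ vZ = idm (dob D W) by [].
have {}vv' : vZ ∘ vZ' = idm Z by [].
pose H := dob D (X ⊗ W); pose chi := dfact D (dev D (X ⊗ W) ∘ asc H X W).
have chiE Y (phi : Mor Y H) : dev D W ∘ ((chi ∘ (phi ⊗ₘ idm X)) ⊗ₘ idm W)
    = dev D (X ⊗ W) ∘ (phi ⊗ₘ idm (X ⊗ W)) ∘ asc Y X W.
  by rewrite -whr (compr1 (dfactK D _)) -compA asc_whr.
exists H, (vZ ∘ chi) => Y g.
exists (dfact D (dev D W ∘ ((vZ' ∘ g) ⊗ₘ idm W) ∘ asci Y X W)); split.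
  rewrite -compA -[RHS](comprK vv'); congr (_ ∘ _).
  apply: dev_inj; rewrite chiE (compr1 (dfactK D _)) -!compA ascK.
  by rewrite compm1.
move=> phi e; apply: dev_inj; rewrite dfactK -e -compA (comprK v'v).
by rewrite (compr1 (chiE _ _)) -!compA asciK compm1.
Qed.

Lemma tensl_coker (D : r_structure C) (U Y Q X : C) (f : Mor U Y) (q : Mor Y Q) :
  is_cokernel f q -> is_cokernel (f ⊗ₘ idm X) (q ⊗ₘ idm X).
Proof.
move=> fq; have eq := coker_epi fq; case: fq => qf0 u; split.
  by rewrite whr qf0 tens0m.
move=> Z g g0; have [H [ep epu]] := internal_hom D X Z.
have inj Y' (a b : Mor Y' H) :
    ep ∘ (a ⊗ₘ idm X) = ep ∘ (b ⊗ₘ idm X) -> a = b.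
  move=> e; have [k [_ uk]] := epu Y' (ep ∘ (a ⊗ₘ idm X)).
  by rewrite -(uk a erefl) -(uk b (esym e)).
have [phi [phiE _]] := epu Y g.
have [|psi [psiE _]] := u H phi.
  by apply: inj; rewrite -whr compA phiE g0 tens0m compm0.
exists (ep ∘ (psi ⊗ₘ idm X)); split; first by rewrite -compA whr psiE.
move=> h hE; have [chi [chiE _]] := epu Q h.
rewrite -chiE; congr (_ ∘ (_ ⊗ₘ _)); apply: eq; apply: inj.
by rewrite psiE -whr compA chiE hE.
Qed.

Lemma tensr_coker (D : r_structure C) (c : braiding C) (U Y Q X : C)
    (f : Mor U Y) (q : Mor Y Q) :
  is_cokernel f q -> is_cokernel (idm X ⊗ₘ f) (idm X ⊗ₘ q).
Proof.
move=> /(tensl_coker D X) fq; have [q0 u] := fq.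
have brK (V W : C) : bri c V W ∘ c V W = idm (V ⊗ W) by case: (brP c V W).
have briK (V W : C) : c V W ∘ bri c V W = idm (W ⊗ V) by case: (brP c V W).
split.
  rewrite -[LHS](comprK (brK X Q)) !(compr2 (br_nat c _ _)).
  by rewrite br_nat (compr1 q0) comp0m compm0.
move=> W g g0; have [|h [hE uh]] := u W (g ∘ bri c X Y).
  rewrite -[LHS]compm1 -(briK X U) -!compA -(compr2 (br_nat c _ _)).
  by rewrite (comprK (brK X Y)) compA g0 comp0m.
exists (h ∘ c X Q); split.
  by rewrite -compA br_nat compA hE -compA brK compm1.
move=> k kE; rewrite (uh (k ∘ bri c X Q)) -?compA ?brK ?compm1 //.
rewrite -kE -!compA; congr (_ ∘ _).
rewrite -[LHS]compm1 -(briK X Y) -!compA -(compr2 (br_nat c _ _)).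
by rewrite (comprK (brK X Q)).
Qed.

End Exactness.

Record algebra (K : fieldType) (C : moncat K) := Algebra {
  acar :> Ob C;
  amul : Mor (acar ⊗ acar) acar;
  aone : Mor (munit C) acar;
  amulA : amul ∘ (amul ⊗ₘ idm acar)
    = amul ∘ (idm acar ⊗ₘ amul) ∘ asc acar acar acar;
  amul1l : amul ∘ (aone ⊗ₘ idm acar) = lun acar;
  amul1r : amul ∘ (idm acar ⊗ₘ aone) = run acar }.

Record comm_algebra (K : fieldType) (C : moncat K) (c : braiding C) := CommAlgebra {
  calg :> algebra C;
  amulC : amul calg ∘ c calg calg = amul calg }.

Section Modules.
Variables (K : fieldType) (C : moncat K) (A : algebra C).

Record lmod := Lmod {
  mcar :> Ob C;
  mact : Mor (A ⊗ mcar) mcar;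
  mactA : mact ∘ (amul A ⊗ₘ idm mcar) = mact ∘ (idm A ⊗ₘ mact) ∘ asc A A mcar;
  mact1 : mact ∘ (aone A ⊗ₘ idm mcar) = lun mcar }.

Implicit Types M N P Q : lmod.

Definition mdefect (M N : lmod) (f : Mor M N) : Mor (A ⊗ M) N :=
  (f ∘ mact M) - (mact N ∘ (idm A ⊗ₘ f)).

Lemma mdefect_is_linear M N : linear (@mdefect M N).
Proof.
move=> a f g; rewrite /mdefect compPl tensmPr compPr scalerBr.
by rewrite opprD addrACA.
Qed.

HB.instance Definition _ (M N : lmod) :=
  GRing.isLinear.Build K (Mor M N) (Mor (A ⊗ M) N) _ (@mdefect M N)
    (@mdefect_is_linear M N).

Definition mhom_space (M N : lmod) : {vspace Mor M N} := lker (linfun (@mdefect M N)).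

Lemma mhomP (M N : lmod) (f : Mor M N) :
  reflect (f ∘ mact M = mact N ∘ (idm A ⊗ₘ f)) (f \in mhom_space M N).
Proof. by rewrite memv_ker lfunE /= subr_eq0; exact: eqP. Qed.

Definition lmod_hom (M N : lmod) : vectType K := subvs_of (mhom_space M N).

Definition lmod_mk M N (f : Mor M N)
    (h : f ∘ mact M = mact N ∘ (idm A ⊗ₘ f)) : lmod_hom M N :=
  Subvs (introT (mhomP f) h).

Lemma lmod_homP M N (f : lmod_hom M N) :
  vsval f ∘ mact M = mact N ∘ (idm A ⊗ₘ vsval f).
Proof. exact/mhomP/subvsP. Qed.

Lemma lmod_id_subproof (M : lmod) : idm M ∘ mact M = mact M ∘ (idm A ⊗ₘ idm M).
Proof. by rewrite tensm1 comp1m compm1. Qed.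

Lemma lmod_comp_subproof (M N P : lmod) (g : lmod_hom N P) (f : lmod_hom M N) :
  (vsval g ∘ vsval f) ∘ mact M = mact P ∘ (idm A ⊗ₘ (vsval g ∘ vsval f)).
Proof. by rewrite -compA lmod_homP (compr2 (lmod_homP _)) whl. Qed.

Definition lmod_id M : lmod_hom M M := lmod_mk (lmod_id_subproof M).
Definition lmod_comp M N P (g : lmod_hom N P) (f : lmod_hom M N) : lmod_hom M P :=
  lmod_mk (lmod_comp_subproof g f).

Lemma lmod_comp1m M N (f : lmod_hom M N) : lmod_comp (lmod_id N) f = f.
Proof. by apply: val_inj; rewrite /= comp1m. Qed.

Lemma lmod_compm1 M N (f : lmod_hom M N) : lmod_comp f (lmod_id M) = f.
Proof. by apply: val_inj; rewrite /= compm1. Qed.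

Lemma lmod_compA M N P Q (h : lmod_hom P Q) (g : lmod_hom N P) (f : lmod_hom M N) :
  lmod_comp h (lmod_comp g f) = lmod_comp (lmod_comp h g) f.
Proof. by apply: val_inj; rewrite /= compA. Qed.

Lemma lmod_compPr M N P (a : K) (g : lmod_hom N P) (f1 f2 : lmod_hom M N) :
  lmod_comp g (a *: f1 + f2) = a *: lmod_comp g f1 + lmod_comp g f2.
Proof. by apply: val_inj; rewrite /= compPr. Qed.

Lemma lmod_compPl M N P (a : K) (g1 g2 : lmod_hom N P) (f : lmod_hom M N) :
  lmod_comp (a *: g1 + g2) f = a *: lmod_comp g1 f + lmod_comp g2 f.
Proof. by apply: val_inj; rewrite /= compPl. Qed.

Definition lmod_cat : lincat K :=
  LinCat lmod_comp1m lmod_compm1 lmod_compA lmod_compPr lmod_compPl.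

Definition regmod : lmod := Lmod (amulA A) (amul1l A).

Section Induction.
Variable X : C.

Definition indact : Mor (A ⊗ (A ⊗ X)) (A ⊗ X) :=
  (amul A ⊗ₘ idm X) ∘ asci A A X.

Lemma indactA : indact ∘ (amul A ⊗ₘ idm (A ⊗ X))
  = indact ∘ (idm A ⊗ₘ indact) ∘ asc A A (A ⊗ X).
Proof.
rewrite /indact -!compA asci_whr (compr1 (whr _ _ _)) amulA -!whr -whl -!compA.
by rewrite (compr2 (esym (asci_nat _ _ _))) pentE.
Qed.

Lemma indact1 : indact ∘ (aone A ⊗ₘ idm (A ⊗ X)) = lun (A ⊗ X).
Proof.
rewrite /indact -compA asci_whr (compr1 (whr _ _ _)) amul1l.
by rewrite -lun_asc -compA asciK compm1.
Qed.

(** The free module [F_A(X)]. *)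
Definition indmod : lmod := Lmod indactA indact1.

End Induction.

End Modules.

Section Braided.
Variables (K : fieldType) (C : moncat K) (c : braiding C).
Implicit Types X Y Z : C.

Lemma brK X Y : bri c X Y ∘ c X Y = idm (X ⊗ Y).
Proof. by case: (brP c X Y). Qed.
Lemma briK X Y : c X Y ∘ bri c X Y = idm (Y ⊗ X).
Proof. by case: (brP c X Y). Qed.

Lemma bri_nat X X' Y Y' (f : Mor X X') (g : Mor Y Y') :
  bri c X' Y' ∘ (g ⊗ₘ f) = (f ⊗ₘ g) ∘ bri c X Y.
Proof.
rewrite -[RHS](comprK (brK X' Y')) (compr2 (br_nat c _ _)) briK.
by rewrite compm1.
Qed.

Lemma br_epi X Y : epi (c X Y).
Proof. exact: epi_inv (briK X Y). Qed.

Lemma br_asc X Y Z : asc Y Z X ∘ c X (Y ⊗ Z)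
  = (idm Y ⊗ₘ c X Z) ∘ asc Y X Z ∘ (c X Y ⊗ₘ idm Z) ∘ asci X Y Z.
Proof.
have h := br_hexr c X Y Z.
rewrite -[LHS]compm1 -(asciK X Y Z) -!compA.
by rewrite (compA (c X _)) (compA (asc Y Z X)) h -!compA.
Qed.

Lemma br_asci X Y Z : asci Z X Y ∘ c (X ⊗ Y) Z
  = (c X Z ⊗ₘ idm Y) ∘ asci X Z Y ∘ (idm X ⊗ₘ c Y Z) ∘ asc X Y Z.
Proof.
have h := br_hexl c X Y Z.
rewrite -[LHS]compm1 -(ascK X Y Z) -!compA.
by rewrite (compA (c _ Z)) (compA (asci Z X Y)) h -!compA.
Qed.

Lemma run_tens1 X : run (X ⊗ munit C) = run X ⊗ₘ idm (munit C).
Proof. by rewrite -[LHS](comprK (runK X)) -run_nat (comprK (runK X)). Qed.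

Lemma lun_tens1 X : lun (munit C ⊗ X) = idm (munit C) ⊗ₘ lun X.
Proof. by rewrite -[LHS](comprK (lunK X)) -lun_nat (comprK (lunK X)). Qed.

Lemma tri_i X Y : (run X ⊗ₘ idm Y) ∘ asci X (munit C) Y = idm X ⊗ₘ lun Y.
Proof. by rewrite -triangle -compA asciK compm1. Qed.

Lemma run_br X : run X ∘ c (munit C) X = lun X.
Proof.
apply: tens1_inj; set v := run X ∘ _.
have vmono Y (f g : Mor Y _) : v ∘ f = v ∘ g -> f = g.
  have vi : (bri c (munit C) X ∘ runi X) ∘ v = idm (munit C ⊗ X).
    by rewrite -compA (comprK (runK X)) brK.
  by move=> e; rewrite -[f](comprK vi) e (comprK vi).
apply: vmono.
have -> : v ∘ (idm (munit C) ⊗ₘ v)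
  = run X ∘ (run X ⊗ₘ idm (munit C)) ∘ (c (munit C) X ⊗ₘ idm (munit C))
    ∘ asci (munit C) X (munit C) ∘ (idm (munit C) ⊗ₘ c (munit C) X).
  rewrite (compr1 (whr _ _ _)) (compr2 (run_nat v)) -run_asc -!compA.
  by rewrite (comprK (asciK _ _ _)) whl.
rewrite /v.
have -> : (c (munit C) X ⊗ₘ idm (munit C)) ∘ asci (munit C) X (munit C)
    ∘ (idm (munit C) ⊗ₘ c (munit C) X)
  = asci X (munit C) (munit C) ∘ c (munit C ⊗ munit C) X
    ∘ asci (munit C) (munit C) X.
  by rewrite br_hexl.
rewrite (compr1 (tri_i _ _)) -(compr2 (br_nat c _ _)) -lun_tens1.
by rewrite -lun_asc -!compA asciK compm1.
Qed.

Lemma lun_bri X : lun X ∘ bri c (munit C) X = run X.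
Proof. by rewrite -run_br -compA briK compm1. Qed.

End Braided.

Lemma cok_ex (K : fieldType) (C : lincat K) (X Y Q Z : C) (f g : Mor X Y)
    (q : Mor Y Q) (h : Mor Y Z) :
  is_cokernel (f - g) q -> h ∘ f = h ∘ g -> exists k, k ∘ q == h.
Proof.
case=> _ u e; have [|k [kE _]] := u Z h; first by rewrite compBr e subrr.
by exists k; apply/eqP.
Qed.

Lemma coeq_eq (K : fieldType) (C : lincat K) (X Y Q : C) (f g : Mor X Y)
    (q : Mor Y Q) : is_cokernel (f - g) q -> q ∘ f = q ∘ g.
Proof. by case=> /eqP; rewrite compBr subr_eq0 => /eqP. Qed.

Section RelTensor.
Variables (K : fieldType) (C : moncat K) (ab : abelian C) (c : braiding C).
Variables (D : r_structure C) (A : comm_algebra c).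
Notation lmod := (lmod A).
Implicit Types (X Y Z : C) (M N P Q : lmod).

(** [M ⊗_A N] is the coequalizer of the following two morphisms, i.e. the
    cokernel of their difference. *)
Definition mbal1 M N : Mor (A ⊗ M ⊗ N) (M ⊗ N) := mact M ⊗ₘ idm N.
Definition mbal2 M N : Mor (A ⊗ M ⊗ N) (M ⊗ N) :=
  (idm M ⊗ₘ mact N) ∘ asc M A N ∘ (c A M ⊗ₘ idm N).

Definition mtens_ob M N : C := coker ab (mbal1 M N - mbal2 M N).
Definition mproj M N : Mor (M ⊗ N) (mtens_ob M N) :=
  cokerm ab (mbal1 M N - mbal2 M N).

(** The right action on a left module, locked so that rewriting with [compA]
    does not unfold it. *)
Fact ract_key : unit. Proof. by []. Qed.
Definition ract M : Mor (M ⊗ A) M := locked_with ract_key (mact M ∘ bri c A M).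

Lemma ract_def M : ract M = mact M ∘ bri c A M.
Proof. by rewrite /ract unlock. Qed.

Lemma ractE M : ract M ∘ c A M = mact M.
Proof. by rewrite ract_def -compA brK compm1. Qed.

Lemma mactAi M :
  mact M ∘ (idm A ⊗ₘ mact M) = mact M ∘ (amul A ⊗ₘ idm M) ∘ asci A A M.
Proof. by rewrite (compr1 (mactA M)) -!compA asciK compm1. Qed.

Lemma lractA M :
  mact M ∘ (idm A ⊗ₘ ract M) ∘ asc A M A = ract M ∘ (mact M ⊗ₘ idm A).
Proof.
rewrite !ract_def -[RHS]compA bri_nat; apply: (@br_epi _ _ c A (A ⊗ M)).
rewrite -!compA brK compm1 br_asc (compr1 (whl _ _ _)) -!compA brK compm1.
rewrite (compr2 (mactAi M)) -!compA (comprK (ascK _ _ _)).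
by rewrite (compr1 (whr _ _ _)) amulC mactAi.
Qed.

Lemma lractAi M :
  mact M ∘ (idm A ⊗ₘ ract M) = ract M ∘ (mact M ⊗ₘ idm A) ∘ asci A M A.
Proof. by rewrite (compA (ract M)) -lractA -!compA asciK compm1. Qed.

Lemma ractA M :
  ract M ∘ (idm M ⊗ₘ amul A) = ract M ∘ (ract M ⊗ₘ idm A) ∘ asci M A A.
Proof.
apply: (@br_epi _ _ c (A ⊗ A) M).
rewrite -!compA -br_nat. rewrite (compr1 (ractE M)) br_asci.
rewrite (compr1 (whr _ _ _)) ractE -(compr23 (lractAi M)).
by rewrite (compr1 (whl _ _ _)) ractE mactA.
Qed.

Lemma ract1 M : ract M ∘ (idm M ⊗ₘ aone A) = run M.
Proof. by rewrite ract_def -compA bri_nat (compr1 (mact1 M)) lun_bri. Qed.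

Lemma ract_hom M N (f : Mor M N) : f ∘ mact M = mact N ∘ (idm A ⊗ₘ f) ->
  f ∘ ract M = ract N ∘ (f ⊗ₘ idm A).
Proof. by move=> e; rewrite !ract_def (compr2 e) -!compA bri_nat. Qed.

Lemma ract_reg : ract (regmod A) = amul A.
Proof.
by rewrite ract_def /= -[amul A in LHS]amulC -compA briK compm1.
Qed.

Definition bal2 M N : Mor (M ⊗ A ⊗ N) (M ⊗ N) := (idm M ⊗ₘ mact N) ∘ asc M A N.

Lemma mprojP M N : is_cokernel ((ract M ⊗ₘ idm N) - bal2 M N) (mproj M N).
Proof.
have e : ((ract M ⊗ₘ idm N) - bal2 M N) ∘ (c A M ⊗ₘ idm N)
    = mbal1 M N - mbal2 M N.
  by rewrite compBl whr ractE /mbal2 /bal2 -!compA.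
have ci : (c A M ⊗ₘ idm N) ∘ (bri c A M ⊗ₘ idm N) = idm _.
  by rewrite whr briK tensm1.
have [q0 u] : is_cokernel (mbal1 M N - mbal2 M N) (mproj M N) := cokermP ab _.
split.
  by rewrite -[LHS]compm1 -ci -!compA (compA _ (c A M ⊗ₘ _)) e compA q0 comp0m.
by move=> W g g0; apply: u; rewrite -e compA g0 comp0m.
Qed.

Lemma mprojlP M N X : is_cokernel
  (ract M ⊗ₘ idm N ⊗ₘ idm X - bal2 M N ⊗ₘ idm X) (mproj M N ⊗ₘ idm X).
Proof. by rewrite -tensBm; apply/(tensl_coker D)/mprojP. Qed.

Lemma mprojrP M N X : is_cokernel
  (idm X ⊗ₘ (ract M ⊗ₘ idm N) - idm X ⊗ₘ bal2 M N) (idm X ⊗ₘ mproj M N).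
Proof. by rewrite -tensmB; apply/(tensr_coker D c)/mprojP. Qed.

Lemma mproj_epi M N : epi (mproj M N).
Proof. exact: coker_epi (mprojP M N). Qed.
Lemma mprojl_epi M N X : epi (mproj M N ⊗ₘ idm X).
Proof. exact: coker_epi (mprojlP M N X). Qed.
Lemma mprojr_epi M N X : epi (idm X ⊗ₘ mproj M N).
Proof. exact: coker_epi (mprojrP M N X). Qed.

Lemma tensl_epi X Y Z (q : Mor X Y) : epi q -> epi (q ⊗ₘ idm Z).
Proof.
by move=> /(epi_normal ab) [W [g /(tensl_coker D Z) /coker_epi]].
Qed.

Lemma tensr_epi X Y Z (q : Mor X Y) : epi q -> epi (idm Z ⊗ₘ q).
Proof.
by move=> /(epi_normal ab) [W [g /(@tensr_coker _ _ D c _ _ _ Z _ _) /coker_epi]].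
Qed.

Lemma mprojE M N :
  mproj M N ∘ (ract M ⊗ₘ idm N) = mproj M N ∘ (idm M ⊗ₘ mact N) ∘ asc M A N.
Proof. exact: coeq_eq (mprojP M N). Qed.

Lemma mtens_act_ex M N : exists act : Mor (A ⊗ mtens_ob M N) (mtens_ob M N),
  act ∘ (idm A ⊗ₘ mproj M N) == mproj M N ∘ (mact M ⊗ₘ idm N) ∘ asci A M N.
Proof.
apply: (cok_ex (mprojrP M N A)); rewrite /bal2 -whl -!compA.
rewrite -asci_nat (compr1 (whr _ _ _)) lractAi -!whr -!compA.
rewrite (compr23 (mprojE M N)) (compr2 (asc_whr _ _ _)) (compr23 (pentD _ _ _ _)).
by rewrite asciK compm1 (compr2 (asci_whl _ _ _)) (compr2 (xch _ _)).
Qed.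

Definition mtens_act M N : Mor (A ⊗ mtens_ob M N) (mtens_ob M N) :=
  xchoose (mtens_act_ex M N).

Lemma mtens_actE M N : mtens_act M N ∘ (idm A ⊗ₘ mproj M N)
  = mproj M N ∘ (mact M ⊗ₘ idm N) ∘ asci A M N.
Proof. exact/eqP/(xchooseP (mtens_act_ex M N)). Qed.

Lemma mtens_actA M N :
  mtens_act M N ∘ (amul A ⊗ₘ idm (mtens_ob M N))
  = mtens_act M N ∘ (idm A ⊗ₘ mtens_act M N) ∘ asc A A (mtens_ob M N).
Proof.
apply: (@mprojr_epi M N (A ⊗ A)); rewrite -!compA xch (compr23 (mtens_actE M N)).
rewrite asci_whr (compr1 (whr _ _ _)) mactA asc_whl (compr1 (whl _ _ _)).
rewrite mtens_actE -!whl -!compA (compr23 (mtens_actE M N)) -!whr -!compA.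
by rewrite pentE (compr2 (asci_nat _ _ _)).
Qed.

Lemma mtens_act1 M N :
  mtens_act M N ∘ (aone A ⊗ₘ idm (mtens_ob M N)) = lun (mtens_ob M N).
Proof.
apply: (@mprojr_epi M N (munit C)).
rewrite -!compA xch (compr23 (mtens_actE M N)) asci_whr (compr1 (whr _ _ _)).
by rewrite mact1 -lun_asc -!compA asciK compm1 lun_nat.
Qed.

Definition mtens M N : lmod := Lmod (mtens_actA M N) (mtens_act1 M N).

Lemma ract_mproj M N : ract (mtens M N) ∘ (mproj M N ⊗ₘ idm A)
  = mproj M N ∘ (idm M ⊗ₘ ract N) ∘ asc M N A.
Proof.
apply: (@br_epi _ _ c A (M ⊗ N)).
rewrite -!compA -br_nat (compr1 (ractE (mtens M N))) mtens_actE.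
rewrite br_asc (compr1 (whl _ _ _)) ractE -(compr23 (mprojE M N)).
by rewrite (compr1 (whr _ _ _)) ractE.
Qed.

Lemma ract_mproji M N : mproj M N ∘ (idm M ⊗ₘ ract N)
  = ract (mtens M N) ∘ (mproj M N ⊗ₘ idm A) ∘ asci M N A.
Proof.
by rewrite (compA (ract _)) ract_mproj -!compA asciK compm1.
Qed.

Lemma mtensm_ex M M' N N' (f : lmod_hom M M') (g : lmod_hom N N') :
  exists h : Mor (mtens_ob M N) (mtens_ob M' N'),
    h ∘ mproj M N == mproj M' N' ∘ (vsval f ⊗ₘ vsval g).
Proof.
apply: (cok_ex (mprojP M N)); rewrite /bal2 -!compA.
rewrite -(tlr (vsval f)) -!compA -xch (compr1 (whr _ _ _)).
rewrite (ract_hom (lmod_homP f)) -whr -!compA (compr23 (mprojE M' N')).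
rewrite (compr2 (asc_whr _ _ _)) asc_whl -(compr2 (xch _ _)).
by rewrite !(compr1 (whl _ _ _)) lmod_homP.
Qed.

Definition mtensm_raw M M' N N' (f : lmod_hom M M') (g : lmod_hom N N') :
    Mor (mtens_ob M N) (mtens_ob M' N') := xchoose (mtensm_ex f g).

Lemma mtensm_rawE M M' N N' (f : lmod_hom M M') (g : lmod_hom N N') :
  mtensm_raw f g ∘ mproj M N = mproj M' N' ∘ (vsval f ⊗ₘ vsval g).
Proof. exact/eqP/(xchooseP (mtensm_ex f g)). Qed.

Lemma mtensm_hom M M' N N' (f : lmod_hom M M') (g : lmod_hom N N') :
  mtensm_raw f g ∘ mact (mtens M N)
  = mact (mtens M' N') ∘ (idm A ⊗ₘ mtensm_raw f g).
Proof.
apply: (@mprojr_epi M N A); rewrite -!compA whl mtensm_rawE -whl.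
rewrite !mtens_actE (compr23 (mtens_actE M' N')) (compr2 (mtensm_rawE f g)).
rewrite -asci_nat !(compr1 (esym (tensmM _ _ _ _))).
by rewrite lmod_homP comp1m compm1.
Qed.

Definition mtensm M M' N N' (f : lmod_hom M M') (g : lmod_hom N N') :
    lmod_hom (mtens M N) (mtens M' N') := @lmod_mk _ _ _ (mtens M N) (mtens M' N') _ (mtensm_hom f g).

Lemma masc1_ex M N P : exists h : Mor (mtens_ob M N ⊗ P) (mtens_ob M (mtens N P)),
  h ∘ (mproj M N ⊗ₘ idm P)
  == mproj M (mtens N P) ∘ (idm M ⊗ₘ mproj N P) ∘ asc M N P.
Proof.
apply: (cok_ex (mprojlP M N P)); rewrite /bal2 -whr -!compA asc_whr.
rewrite -(compr2 (xch _ _)) (compr23 (mprojE M (mtens N P))).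
rewrite (compr2 (asc_whl _ _ _)) (compr1 (whl _ _ _)) mtens_actE -!whl -!compA.
rewrite (compr2 (asc_nat _ _ _)) pentB.
by [].
Qed.

Definition masc1 M N P := xchoose (masc1_ex M N P).

Lemma masc1E M N P : masc1 M N P ∘ (mproj M N ⊗ₘ idm P)
  = mproj M (mtens N P) ∘ (idm M ⊗ₘ mproj N P) ∘ asc M N P.
Proof. exact/eqP/(xchooseP (masc1_ex M N P)). Qed.

Lemma masc_ex M N P :
  exists h : Mor (mtens_ob (mtens M N) P) (mtens_ob M (mtens N P)),
  h ∘ mproj (mtens M N) P == masc1 M N P.
Proof.
apply: (cok_ex (mprojP (mtens M N) P)).
apply: (tensl_epi (tensl_epi (@mproj_epi M N) (Z := A)) (Z := P)).
rewrite /bal2 -!compA whr ract_mproj -!whr (compr23 (masc1E M N P)).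
rewrite (compr2 (asc_nat _ _ _)) (compr1 (whl _ _ _)) mprojE -!whl -!compA pentagon.
rewrite asc_whr -(compr2 (xch _ _)) (compr23 (masc1E M N P)).
by rewrite (compr2 (asc_whl _ _ _)).
Qed.

Definition masc_raw M N P :
    Mor (mtens_ob (mtens M N) P) (mtens_ob M (mtens N P)) :=
  xchoose (masc_ex M N P).

Lemma masc_rawE M N P :
  masc_raw M N P ∘ mproj (mtens M N) P ∘ (mproj M N ⊗ₘ idm P)
  = mproj M (mtens N P) ∘ (idm M ⊗ₘ mproj N P) ∘ asc M N P.
Proof. by rewrite (compr1 (eqP (xchooseP (masc_ex M N P)))) masc1E. Qed.

Lemma masci1_ex M N P : exists h : Mor (M ⊗ mtens_ob N P) (mtens_ob (mtens M N) P),
  h ∘ (idm M ⊗ₘ mproj N P)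
  == mproj (mtens M N) P ∘ (mproj M N ⊗ₘ idm P) ∘ asci M N P.
Proof.
apply: (cok_ex (mprojrP N P M)); rewrite /bal2 -whl -!compA -asci_nat.
rewrite (compr1 (whr _ _ _)) ract_mproji -!whr -!compA.
rewrite (compr23 (mprojE (mtens M N) P)) (compr2 (asc_whr _ _ _)).
rewrite -(compr2 (xch _ _)) (compr23 (pentD _ _ _ _)) asciK compm1.
by rewrite (compr2 (asci_whl _ _ _)).
Qed.

Definition masci1 M N P := xchoose (masci1_ex M N P).

Lemma masci1E M N P : masci1 M N P ∘ (idm M ⊗ₘ mproj N P)
  = mproj (mtens M N) P ∘ (mproj M N ⊗ₘ idm P) ∘ asci M N P.
Proof. exact/eqP/(xchooseP (masci1_ex M N P)). Qed.

Lemma masci_ex M N P :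
  exists h : Mor (mtens_ob M (mtens N P)) (mtens_ob (mtens M N) P),
  h ∘ mproj M (mtens N P) == masci1 M N P.
Proof.
apply: (cok_ex (mprojP M (mtens N P))).
apply: (tensr_epi (@mproj_epi N P) (Z := M ⊗ A)).
rewrite /bal2 -!compA xch (compr23 (masci1E M N P)) asci_whr.
rewrite (compr1 (whr _ _ _)) mprojE -!whr -!compA asc_whl (compr1 (whl _ _ _)).
rewrite mtens_actE -!whl -!compA (compr23 (masci1E M N P)).
by rewrite -(compr2 (asci_nat _ _ _)) pentE.
Qed.

Definition masci_raw M N P :
    Mor (mtens_ob M (mtens N P)) (mtens_ob (mtens M N) P) :=
  xchoose (masci_ex M N P).

Lemma masci_rawE M N P :
  masci_raw M N P ∘ mproj M (mtens N P) ∘ (idm M ⊗ₘ mproj N P)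
  = mproj (mtens M N) P ∘ (mproj M N ⊗ₘ idm P) ∘ asci M N P.
Proof. by rewrite (compr1 (eqP (xchooseP (masci_ex M N P)))) masci1E. Qed.

Lemma masc_epi M N P : epi (mproj (mtens M N) P ∘ (mproj M N ⊗ₘ idm P)).
Proof. by apply: epi_comp; [exact: mproj_epi | apply/tensl_epi/mproj_epi]. Qed.

Lemma masci_epi M N P : epi (mproj M (mtens N P) ∘ (idm M ⊗ₘ mproj N P)).
Proof. by apply: epi_comp; [exact: mproj_epi | apply/tensr_epi/mproj_epi]. Qed.

Lemma masc_hom M N P :
  masc_raw M N P ∘ mact (mtens (mtens M N) P)
  = mact (mtens M (mtens N P)) ∘ (idm A ⊗ₘ masc_raw M N P).
Proof.
apply: (tensr_epi (@masc_epi M N P) (Z := A)).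
rewrite -!compA !whl masc_rawE -!whl (compr23 (mtens_actE (mtens M N) P)).
rewrite -asci_nat (compr1 (whr _ _ _)) mtens_actE -!whr -!compA.
rewrite (compr3 (masc_rawE M N P)) -!compA (compr2 (asc_whr _ _ _)).
rewrite (compr23 (pentD _ _ _ _)) asciK compm1.
rewrite (compr23 (mtens_actE M (mtens N P))) (compr2 (asci_whl _ _ _)).
by rewrite (compr2 (xch _ _)).
Qed.

Lemma masc_rawK M N P :
  masci_raw M N P ∘ masc_raw M N P = idm (mtens_ob (mtens M N) P).
Proof.
apply: (@masc_epi M N P); rewrite -compA masc_rawE (compr3 (masci_rawE M N P)).
by rewrite -!compA ascK compm1 comp1m.
Qed.

Lemma masci_rawK M N P :
  masc_raw M N P ∘ masci_raw M N P = idm (mtens_ob M (mtens N P)).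
Proof.
apply: (@masci_epi M N P); rewrite -compA masci_rawE (compr3 (masc_rawE M N P)).
by rewrite -!compA asciK compm1 comp1m.
Qed.

Lemma inv_hom M N (f : Mor M N) (g : Mor N M) :
  g ∘ f = idm M -> f ∘ g = idm N -> f ∘ mact M = mact N ∘ (idm A ⊗ₘ f) ->
  g ∘ mact N = mact M ∘ (idm A ⊗ₘ g).
Proof.
move=> gf fg e; rewrite -[RHS](comprK gf) (compr2 e) whl fg tensm1.
by rewrite compm1.
Qed.

Lemma masci_hom M N P :
  masci_raw M N P ∘ mact (mtens M (mtens N P))
  = mact (mtens (mtens M N) P) ∘ (idm A ⊗ₘ masci_raw M N P).
Proof. 
exact: (@inv_hom (mtens (mtens M N) P) (mtens M (mtens N P)) _ _
  (masc_rawK M N P) (masci_rawK M N P) (masc_hom M N P)). Qed.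

Definition masc M N P : lmod_hom (mtens (mtens M N) P) (mtens M (mtens N P)) :=
  @lmod_mk _ _ _ (mtens (mtens M N) P) (mtens M (mtens N P)) _ (masc_hom M N P).
Definition masci M N P : lmod_hom (mtens M (mtens N P)) (mtens (mtens M N) P) :=
  @lmod_mk _ _ _ (mtens M (mtens N P)) (mtens (mtens M N) P) _ (masci_hom M N P).

Notation Areg := (regmod A).

Lemma mlun_ex M : exists h : Mor (mtens_ob Areg M) M, h ∘ mproj Areg M == mact M.
Proof.
by apply: (cok_ex (mprojP Areg M)); rewrite ract_reg mactA /bal2.
Qed.

Definition mlun_raw M : Mor (mtens_ob Areg M) M := xchoose (mlun_ex M).

Lemma mlun_rawE M : mlun_raw M ∘ mproj Areg M = mact M.
Proof. exact/eqP/(xchooseP (mlun_ex M)). Qed.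

Lemma mlun_hom M : mlun_raw M ∘ mact (mtens Areg M)
  = mact M ∘ (idm A ⊗ₘ mlun_raw M).
Proof.
apply: (tensr_epi (@mproj_epi Areg M) (Z := A)).
rewrite -!compA whl mlun_rawE mtens_actE (compr1 (mlun_rawE M)).
by rewrite mactAi.
Qed.

Definition mluni_raw M : Mor M (mtens_ob Areg M) :=
  mproj Areg M ∘ (aone A ⊗ₘ idm M) ∘ luni M.

Lemma mlun_rawK M : mluni_raw M ∘ mlun_raw M = idm (mtens_ob Areg M).
Proof.
apply: (@mproj_epi Areg M); rewrite /mluni_raw -!compA mlun_rawE luni_nat.
rewrite (compr2 (xch _ _)).
have e : mproj Areg M ∘ (idm A ⊗ₘ mact M)
    = mproj Areg M ∘ (amul A ⊗ₘ idm M) ∘ asci A A M.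
  by rewrite -ract_reg (compr23 (mprojE Areg M)) asciK compm1.
rewrite (compr23 e) (compr2 (asci_whr _ _ _)) (compr1 (whr _ _ _)) amul1l.
by rewrite -lun_asc -!compA (comprK (asciK _ _ _)) luniK comp1m compm1.
Qed.

Lemma mluni_rawK M : mlun_raw M ∘ mluni_raw M = idm M.
Proof.
by rewrite /mluni_raw (compr1 (mlun_rawE M)) (compr1 (mact1 M)) luniK.
Qed.

Lemma mluni_hom M : mluni_raw M ∘ mact M
  = mact (mtens Areg M) ∘ (idm A ⊗ₘ mluni_raw M).
Proof. 
exact: (@inv_hom (mtens Areg M) M _ _ (mlun_rawK M) (mluni_rawK M) (mlun_hom M)). Qed.

Definition mlun M : lmod_hom (mtens Areg M) M := @lmod_mk _ _ _ (mtens Areg M) M _ (mlun_hom M).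
Definition mluni M : lmod_hom M (mtens Areg M) := @lmod_mk _ _ _ M (mtens Areg M) _ (mluni_hom M).

(** A left module is a right module through [c^-1]; the coequalizer above
    identifies this right action on [M] with the left action on [N]. *)
Lemma mrun_ex M : exists h : Mor (mtens_ob M Areg) M,
  h ∘ mproj M Areg == mact M ∘ bri c A M.
Proof.
apply: (cok_ex (mprojP M Areg)); rewrite -ract_def.
by rewrite /bal2 (compr23 (ractA M)) ascK compm1.
Qed.

Definition mrun_raw M : Mor (mtens_ob M Areg) M := xchoose (mrun_ex M).

Lemma mrun_rawE M : mrun_raw M ∘ mproj M Areg = ract M.
Proof. by rewrite (eqP (xchooseP (mrun_ex M))) ract_def. Qed.

Lemma mrun_hom M : mrun_raw M ∘ mact (mtens M Areg)
  = mact M ∘ (idm A ⊗ₘ mrun_raw M).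
Proof.
apply: (tensr_epi (@mproj_epi M Areg) (Z := A)).
rewrite -!compA whl mrun_rawE mtens_actE (compr1 (mrun_rawE M)).
by rewrite lractAi.
Qed.

Definition mruni_raw M : Mor M (mtens_ob M Areg) :=
  mproj M Areg ∘ (idm M ⊗ₘ aone A) ∘ runi M.

Lemma mrun_rawK M : mruni_raw M ∘ mrun_raw M = idm (mtens_ob M Areg).
Proof.
apply: (@mproj_epi M Areg); rewrite /mruni_raw -!compA mrun_rawE runi_nat.
rewrite -(compr2 (xch _ _)).
have e : mproj M Areg ∘ (ract M ⊗ₘ idm A)
    = mproj M Areg ∘ (idm M ⊗ₘ amul A) ∘ asc M A A := mprojE M Areg.
rewrite (compr23 e) (compr2 (asc_whl _ _ _)) (compr1 (whl _ _ _)) amul1r.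
by rewrite (compr1 (run_asc _ _)) runiK comp1m compm1.
Qed.

Lemma mruni_rawK M : mrun_raw M ∘ mruni_raw M = idm M.
Proof.
by rewrite /mruni_raw (compr1 (mrun_rawE M)) (compr1 (ract1 M)) runiK.
Qed.

Lemma mruni_hom M : mruni_raw M ∘ mact M
  = mact (mtens M Areg) ∘ (idm A ⊗ₘ mruni_raw M).
Proof. 
exact: (@inv_hom (mtens M Areg) M _ _ (mrun_rawK M) (mruni_rawK M) (mrun_hom M)). Qed.

Definition mrun M : lmod_hom (mtens M Areg) M := @lmod_mk _ _ _ (mtens M Areg) M _ (mrun_hom M).
Definition mruni M : lmod_hom M (mtens M Areg) := @lmod_mk _ _ _ M (mtens M Areg) _ (mruni_hom M).

Lemma lmod_inj M N (f g : lmod_hom M N) : vsval f = vsval g -> f = g.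
Proof. exact: val_inj. Qed.

Lemma val_lmodP M N (a : K) (f g : lmod_hom M N) :
  vsval (a *: f + g : lmod_hom M N) = a *: vsval f + vsval g.
Proof. by []. Qed.

Lemma val_lmod_comp M N P (g : lmod_hom N P) (f : lmod_hom M N) :
  vsval (lmod_comp g f) = vsval g ∘ vsval f.
Proof. by []. Qed.

Lemma val_lmod_id M : vsval (lmod_id M) = idm M.
Proof. by []. Qed.

Lemma mtensmE M M' N N' (f : lmod_hom M M') (g : lmod_hom N N') :
  vsval (mtensm f g) ∘ mproj M N = mproj M' N' ∘ (vsval f ⊗ₘ vsval g).
Proof. exact: mtensm_rawE. Qed.

Lemma mascE M N P :
  vsval (masc M N P) ∘ mproj (mtens M N) P ∘ (mproj M N ⊗ₘ idm P)
  = mproj M (mtens N P) ∘ (idm M ⊗ₘ mproj N P) ∘ asc M N P.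
Proof. exact: masc_rawE. Qed.

Lemma mlunE M : vsval (mlun M) ∘ mproj Areg M = mact M.
Proof. exact: mlun_rawE. Qed.

Lemma mrunE M : vsval (mrun M) ∘ mproj M Areg = ract M.
Proof. exact: mrun_rawE. Qed.

Lemma mtensm1 M N : mtensm (lmod_id M) (lmod_id N) = lmod_id (mtens M N).
Proof.
apply/lmod_inj/(@mproj_epi M N).
by rewrite mtensmE !val_lmod_id tensm1 compm1 comp1m.
Qed.

Lemma mtensmM M M' M'' N N' N'' (f' : lmod_hom M' M'') (f : lmod_hom M M')
    (g' : lmod_hom N' N'') (g : lmod_hom N N') :
  mtensm (lmod_comp f' f) (lmod_comp g' g) = lmod_comp (mtensm f' g') (mtensm f g).
Proof.
apply/lmod_inj/(@mproj_epi M N); rewrite val_lmod_comp -compA !mtensmE.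
by rewrite (compr2 (mtensmE _ _)) -tensmM.
Qed.

Lemma mtensmPl M M' N N' (a : K) (f1 f2 : lmod_hom M M') (g : lmod_hom N N') :
  mtensm (a *: f1 + f2) g = a *: mtensm f1 g + mtensm f2 g.
Proof.
apply/lmod_inj/(@mproj_epi M N); rewrite mtensmE !val_lmodP compPl.
by rewrite !mtensmE tensmPl compPr.
Qed.

Lemma mtensmPr M M' N N' (a : K) (f : lmod_hom M M') (g1 g2 : lmod_hom N N') :
  mtensm f (a *: g1 + g2) = a *: mtensm f g1 + mtensm f g2.
Proof.
apply/lmod_inj/(@mproj_epi M N); rewrite mtensmE !val_lmodP compPl.
by rewrite !mtensmE tensmPr compPr.
Qed.

Lemma mascP M N P : inverse_of (C := lmod_cat A) (masc M N P) (masci M N P).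
Proof. by split; apply: lmod_inj; [exact: masc_rawK | exact: masci_rawK]. Qed.

Lemma mtensmEl M M' N N' P P' (f : lmod_hom M M') (g : lmod_hom N N')
    (h : lmod_hom P P') :
  (vsval (mtensm f g) ⊗ₘ vsval h) ∘ (mproj M N ⊗ₘ idm P)
  = (mproj M' N' ⊗ₘ idm P') ∘ (vsval f ⊗ₘ vsval g ⊗ₘ vsval h).
Proof. by rewrite -!tensmM mtensmE compm1 comp1m. Qed.

Lemma mtensmEr M M' N N' P P' (f : lmod_hom M M') (g : lmod_hom N N')
    (h : lmod_hom P P') :
  (vsval f ⊗ₘ vsval (mtensm g h)) ∘ (idm M ⊗ₘ mproj N P)
  = (idm M' ⊗ₘ mproj N' P') ∘ (vsval f ⊗ₘ (vsval g ⊗ₘ vsval h)).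
Proof. by rewrite -!tensmM mtensmE compm1 comp1m. Qed.

Lemma masc_nat M M' N N' P P' (f : lmod_hom M M') (g : lmod_hom N N')
    (h : lmod_hom P P') :
  lmod_comp (masc M' N' P') (mtensm (mtensm f g) h)
  = lmod_comp (mtensm f (mtensm g h)) (masc M N P).
Proof.
apply/lmod_inj/(@masc_epi M N P); rewrite !val_lmod_comp -!compA.
rewrite mascE (compr2 (mtensmE (mtensm f g) h)) mtensmEl (compr3 (mascE M' N' P')).
rewrite (compr2 (mtensmE f (mtensm g h))) (compr2 (mtensmEr f g h)) -!compA.
by rewrite asc_nat.
Qed.

Lemma mlunP M : inverse_of (C := lmod_cat A) (mlun M) (mluni M).
Proof. by split; apply: lmod_inj; [exact: mlun_rawK | exact: mluni_rawK]. Qed.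

Lemma mlun_nat M N (f : lmod_hom M N) :
  lmod_comp (mlun N) (mtensm (lmod_id Areg) f) = lmod_comp f (mlun M).
Proof.
apply/lmod_inj/(@mproj_epi Areg M); rewrite !val_lmod_comp -!compA.
by rewrite mlunE mtensmE (compr1 (mlunE N)) lmod_homP.
Qed.

Lemma mrunP M : inverse_of (C := lmod_cat A) (mrun M) (mruni M).
Proof. by split; apply: lmod_inj; [exact: mrun_rawK | exact: mruni_rawK]. Qed.

Lemma mrun_nat M N (f : lmod_hom M N) :
  lmod_comp (mrun N) (mtensm f (lmod_id Areg)) = lmod_comp f (mrun M).
Proof.
apply/lmod_inj/(@mproj_epi M Areg); rewrite !val_lmod_comp -!compA.
rewrite mrunE mtensmE (compr1 (mrunE N)).
by rewrite (ract_hom (lmod_homP f)).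
Qed.

Lemma mpentagon M N P Q :
  lmod_comp (mtensm (lmod_id M) (masc N P Q))
    (lmod_comp (masc M (mtens N P) Q) (mtensm (masc M N P) (lmod_id Q)))
  = lmod_comp (masc M N (mtens P Q)) (masc (mtens M N) P Q).
Proof.
apply/lmod_inj; rewrite !val_lmod_comp.
apply: (epi_comp (@mproj_epi (mtens (mtens M N) P) Q)
  (tensl_epi (@masc_epi M N P) (Z := Q))).
rewrite -!compA (compr2 (mtensmE (masc M N P) (lmod_id Q))) val_lmod_id.
rewrite whr mascE -!whr (compr3 (mascE M (mtens N P) Q)) -!compA.
rewrite (compr2 (mtensmE (lmod_id M) (masc N P Q))) val_lmod_id.
rewrite (compr2 (asc_nat _ _ _)) !(compr1 (whl _ _ _)) -!compA mascE -!whl -!compA.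
rewrite pentagon.
rewrite (compr3 (mascE (mtens M N) P Q)) -!compA asc_whr -(compr2 (xch _ _)).
by rewrite (compr3 (mascE M N (mtens P Q))) -!compA (compr2 (asc_whl _ _ _)).
Qed.

Lemma mtriangle M N :
  lmod_comp (mtensm (lmod_id M) (mlun N)) (masc M Areg N)
  = mtensm (mrun M) (lmod_id N).
Proof.
apply/lmod_inj/(@masc_epi M Areg N); rewrite !val_lmod_comp -!compA mascE.
rewrite (compr2 (mtensmE (lmod_id M) (mlun N))).
rewrite (compr2 (mtensmE (mrun M) (lmod_id N))) !val_lmod_id.
rewrite (compr1 (whl _ _ _)) whr mlunE mrunE.
by rewrite mprojE.
Qed.

Definition lmod_moncat : moncat K :=
  @MonCat K (lmod_cat A) Areg mtens mtensm mtensm1 mtensmM mtensmPl mtensmPr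
    masc masci mascP masc_nat mlun mluni mlunP mlun_nat mrun mruni mrunP mrun_nat
    mpentagon mtriangle.

Definition local (M : lmod) : Prop :=
  mact M ∘ c M A ∘ c A M = mact M.

Lemma localE M : local M <-> mact M ∘ c M A = ract M.
Proof.
split=> e; last by rewrite /local (compA (mact M)) e ractE.
by apply: (@br_epi _ _ c A M); rewrite -compA [LHS]e ractE.
Qed.

Lemma local_unit : local Areg.
Proof. by rewrite /local /= (compr1 (amulC A)) amulC. Qed.

Lemma local_tens M N : local M -> local N -> local (mtens M N).
Proof.
move=> /localE lM /localE lN; apply/localE.
apply: (tensl_epi (@mproj_epi M N) (Z := A)); rewrite ract_mproj.
rewrite -compA br_nat (compr23 (mtens_actE M N)) br_asci (compr1 (whr _ _ _)) lM.
rewrite (compr23 (mprojE M N)) (comprK (asciK _ _ _)) (compr1 (whl _ _ _)).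
by rewrite lN.
Qed.

Definition loc_moncat : moncat K :=
  fullsub_moncat (C := lmod_moncat) local_unit local_tens.

End RelTensor.

(* Main.v *)
Require Import Defs.
From mathcomp Require Import all_boot all_algebra.
From Stdlib Require Import Classical.
(* [compA] is to mean associativity of composition of morphisms. *)
Import Defs.

Set Implicit Arguments.
Unset Strict Implicit.
Unset Printing Implicit Defensive.

Import GRing.Theory.
Local Open Scope ring_scope.

(** Let [X] be simple with [ev : DX ⊗ X -> 1]. It suffices to find a
    coevaluation [1 -> X ⊗ DX] for [ev]: left duals then pass from simple objects
    to all objects of finite length, and they give right duals because every
    object is isomorphic to some [DY] ([rigid_of_left_duals]).

    Extensions. If [0 -> L -> M -> R -> 0] is exact, [L] and [R] have left duals
    [L'] and [R'], and [L' ⊗ -] preserves monomorphisms, then [M] has a left dual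
    ([left_dual_extension]); this needs only an abelian category with right exact
    tensor products. The same lemma serves twice: in [C], and in the category of
    [A]-modules, where simple modules have duals because they are local. Every
    nonzero module contains a simple one and module length is bounded by the
    length of the underlying object, so all modules have left duals
    ([all_dualizable]).

    Free modules. The pairing [F(DX) ⊗_A F(X) -> A] induced by [ev] is nonzero,
    so that the comparison [F(DX) -> F(X)^*] is invertible and [F(ev)] is an
    evaluation for [F(X)]. Through [Hom_A(F(Z), N) = Hom(Z, N)] and
    [M ⊗_A F(X) = M ⊗ X] this becomes a statement in [C]
    ([simple_free_pairing]): contraction with [ev] is injective on
    [Hom(Z, M ⊗ DX)] for every module [M], and there is [i : 1 -> A ⊗ X ⊗ DX]
    whose contraction with [X] is the unit [X -> A ⊗ X].

    Descent of [i] from [A] to the unit object. Move an object [Z] across [A],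
    with [c] or with its inverse, in [Z ⊗ i]. The contraction of the result is in
    both cases the unit [Z ⊗ X -> A ⊗ Z ⊗ X], so injectivity shows that the two
    results agree ([acoev_transparent]). Now contract the factor [X ⊗ DX] of [i]
    with any [B], to get [B -> A] with image [S]: the braiding of [Z] with [S] and
    its inverse agree after the inclusion of [S ⊗ Z] into [A ⊗ Z], for every [Z].
    By the hypothesis [hc] this forces [S] to lie in the unit object
    ([trace_in_unit]). For [B = D(X ⊗ DX)] the resulting morphism [B -> 1] is dual
    to some [i0 : 1 -> X ⊗ DX], because [D] is full. The morphisms [i] and [i0]
    then have the same pairing with [X ⊗ DX], and as [A] contains the unit
    object this pairing determines the zigzag of [i0], which is therefore the
    identity ([duality_of_nested_ev]). *)

(** * Linear and abelian categories *)

Section Additive.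
Variables (K : fieldType) (C : lincat K).
Implicit Types X Y Z : C.

Lemma compDr X Y Z (g : Mor Y Z) (f1 f2 : Mor X Y) :
  g ∘ (f1 + f2) = (g ∘ f1) + (g ∘ f2).
Proof. by have := compPr 1 g f1 f2; rewrite !scale1r. Qed.

Lemma compDl X Y Z (g1 g2 : Mor Y Z) (f : Mor X Y) :
  (g1 + g2) ∘ f = (g1 ∘ f) + (g2 ∘ f).
Proof. by have := compPl 1 g1 g2 f; rewrite !scale1r. Qed.

Lemma compNr X Y Z (g : Mor Y Z) (f : Mor X Y) : g ∘ (- f) = - (g ∘ f).
Proof. by rewrite -[- f]sub0r compBr compm0 sub0r. Qed.

Lemma compNl X Y Z (g : Mor Y Z) (f : Mor X Y) : (- g) ∘ f = - (g ∘ f).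
Proof. by rewrite -[- g]sub0r compBl comp0m sub0r. Qed.

Lemma monoP X Y (f : Mor X Y) :
  (forall W (w : Mor W X), f ∘ w = 0 -> w = 0) -> mono f.
Proof.
by move=> h W a b e; apply/eqP; rewrite -subr_eq0 (h _ (a - b)) // compBr e subrr.
Qed.

Lemma epiP X Y (f : Mor X Y) :
  (forall W (w : Mor Y W), w ∘ f = 0 -> w = 0) -> epi f.
Proof.
by move=> h W a b e; apply/eqP; rewrite -subr_eq0 (h _ (a - b)) // compBl e subrr.
Qed.

Lemma mono0 X Y W (f : Mor X Y) (w : Mor W X) : mono f -> f ∘ w = 0 -> w = 0.
Proof. by move=> mf e; apply: mf; rewrite e compm0. Qed.

Lemma epi0 X Y W (f : Mor X Y) (w : Mor Y W) : epi f -> w ∘ f = 0 -> w = 0.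
Proof. by move=> ef e; apply: ef; rewrite e comp0m. Qed.

Lemma zero_objectP X : zero_object X <-> idm X = 0.
Proof.
split=> [[h _] | e0].
  by have [z [_ u]] := h X; rewrite -(u (idm X) I) (u 0 I).
split=> Y; exists 0; split=> // f _.
  by rewrite -[f]compm1 e0 compm0.
by rewrite -[f]comp1m e0 comp0m.
Qed.

Lemma iso_epi X Y (f : Mor X Y) : iso f -> epi f.
Proof. by case=> g [_ fg]; exact: epi_inv fg. Qed.

Lemma iso_mono X Y (f : Mor X Y) : iso f -> mono f.
Proof.
by case=> g [gf _] W a b e; rewrite -[a](comprK gf) e (comprK gf).
Qed.

Lemma mono_comp X Y Z (g : Mor Y Z) (f : Mor X Y) : mono g -> mono f -> mono (g ∘ f).
Proof. by move=> mg mf W a b; rewrite -!compA => /mg /mf. Qed.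

Lemma mono_fact X Y Z (g : Mor Y Z) (f : Mor X Y) : mono (g ∘ f) -> mono f.
Proof. by move=> m W a b e; apply: m; rewrite -!compA e. Qed.

Lemma cok_epi X Y Q (f : Mor X Y) (q : Mor Y Q) : is_cokernel f q -> epi q.
Proof.
case=> q0 u W g h e; have [|k [_ uk]] := u W (g ∘ q).
  by rewrite -compA q0 compm0.
by rewrite -(uk g erefl) -(uk h).
Qed.

Lemma ker_mono N X Y (k : Mor N X) (f : Mor X Y) : is_kernel k f -> mono k.
Proof.
case=> k0 u W g h e; have [|l [_ ul]] := u W (k ∘ g).
  by rewrite compA k0 comp0m.
by rewrite -(ul g erefl) -(ul h).
Qed.

Lemma ker_lift N X Y W (k : Mor N X) (f : Mor X Y) (g : Mor W X) :
  is_kernel k f -> f ∘ g = 0 -> exists h, g = k ∘ h.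
Proof. by case=> _ u /u [h [<- _]]; exists h. Qed.

Lemma coker_lift Q X Y W (f : Mor X Y) (q : Mor Y Q) (g : Mor Y W) :
  is_cokernel f q -> g ∘ f = 0 -> exists h, g = h ∘ q.
Proof. by case=> _ u /u [h [<- _]]; exists h. Qed.

Lemma kerI N X Y (k : Mor N X) (f : Mor X Y) : mono k -> f ∘ k = 0 ->
  (forall W (g : Mor W X), f ∘ g = 0 -> exists h, g = k ∘ h) -> is_kernel k f.
Proof.
move=> mk k0 l; split=> // W g /l [h e]; exists h; split=> // h' e'.
by apply: mk; rewrite e'.
Qed.

Lemma cokerI Q X Y (f : Mor X Y) (q : Mor Y Q) : epi q -> q ∘ f = 0 ->
  (forall W (g : Mor Y W), g ∘ f = 0 -> exists h, g = h ∘ q) -> is_cokernel f q.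
Proof.
move=> eq q0 l; split=> // W g /l [h e]; exists h; split=> // h' e'.
by apply: eq; rewrite e'.
Qed.

Lemma coker_uniq Q Q' X Y (f : Mor X Y) (q : Mor Y Q) (q' : Mor Y Q') :
  is_cokernel f q -> is_cokernel f q' -> exists2 u : Mor Q Q', iso u & u ∘ q = q'.
Proof.
move=> c c'; have [u uE] := coker_lift c c'.1; have [v vE] := coker_lift c' c.1.
exists u => //; exists v; split.
  by apply: (cok_epi c); rewrite -compA -uE -vE comp1m.
by apply: (cok_epi c'); rewrite -compA -vE -uE comp1m.
Qed.

Definition ses S X Q (s : Mor S X) (q : Mor X Q) := is_kernel s q /\ is_cokernel s q.

(** A morphism that is a kernel of anything is a kernel of its cokernel. *)
Lemma normal_mono_ker S X Z Q (s : Mor S X) (g : Mor X Z) (q : Mor X Q) :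
  is_kernel s g -> is_cokernel s q -> ses s q.
Proof.
move=> k c; split=> //; apply: kerI (ker_mono k) c.1 _ => W w qw.
by apply: (ker_lift k); have [h ->] := coker_lift c k.1; rewrite -compA qw compm0.
Qed.

Lemma normal_epi_coker S X Z Q (s : Mor S X) (g : Mor Z X) (q : Mor X Q) :
  is_cokernel g q -> is_kernel s q -> ses s q.
Proof.
move=> c k; split=> //; apply: cokerI (cok_epi c) k.1 _ => W w qw.
by apply: (coker_lift c); have [h ->] := ker_lift k c.1; rewrite compA qw comp0m.
Qed.

End Additive.

Section Abelian.
Variables (K : fieldType) (C : lincat K) (ab : abelian C).
Implicit Types X Y Z : C.

Lemma mono_ses S X Q (s : Mor S X) (q : Mor X Q) :
  mono s -> is_cokernel s q -> ses s q.
Proof. by move=> /(mono_normal ab) [Z [g k]]; exact: normal_mono_ker k. Qed.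

Lemma epi_ses S X Q (s : Mor S X) (q : Mor X Q) :
  epi q -> is_kernel s q -> ses s q.
Proof. by move=> /(epi_normal ab) [Z [g k]]; exact: normal_epi_coker k. Qed.

Lemma mono_epi_iso X Y (f : Mor X Y) : mono f -> epi f -> iso f.
Proof.
move=> /(mono_normal ab) [Z [g k]] ef.
have g0 : g = 0 by apply: (epi0 ef); exact: k.1.
have [|h hE] := ker_lift (g := idm Y) k; first by rewrite g0 comp0m.
exists h; split=> //; apply: (ker_mono k).
by rewrite compA -hE comp1m compm1.
Qed.

Lemma ses_zero_quotient S X Q (s : Mor S X) (q : Mor X Q) :
  ses s q -> zero_object Q -> iso s.
Proof.
move=> sq /zero_objectP Q0; apply: (mono_epi_iso (ker_mono sq.1)).
apply: epiP => W w /(coker_lift sq.2) [h ->].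
by rewrite -[h]compm1 Q0 compm0 comp0m.
Qed.

Lemma bpr2_in1 X Y : bpr2 ab X Y ∘ bin1 ab X Y = 0.
Proof.
have /(congr1 (fun u => bpr2 ab X Y ∘ u ∘ bin1 ab X Y)) := bin_pr ab X Y.
rewrite compDl -!compA bpr1_in1 compm1 comp1m.
rewrite compDr (comprK (bpr2_in2 ab X Y)).
move=> /(congr1 (fun u => u - (bpr2 ab X Y ∘ bin1 ab X Y))).
by rewrite addrK subrr.
Qed.

Lemma bpr1_in2 X Y : bpr1 ab X Y ∘ bin2 ab X Y = 0.
Proof.
have /(congr1 (fun u => bpr1 ab X Y ∘ u ∘ bin2 ab X Y)) := bin_pr ab X Y.
rewrite compDl -!compA bpr2_in2 compm1 comp1m.
rewrite compDr (comprK (bpr1_in1 ab X Y)).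
move=> /(congr1 (fun u => u - (bpr1 ab X Y ∘ bin2 ab X Y))).
by rewrite addrK subrr.
Qed.

(** The pullback of [f] and [- g]. That epimorphisms are stable under pullback is
    what makes reasoning with generalized elements possible below: the map [d]
    out of the biproduct is epi, hence the cokernel of its kernel [E], so a
    morphism out of [Y] that vanishes on [E] factors through [d], and the
    factor vanishes because it vanishes on the image of [f]. *)
Lemma fiber_sum X Y Z (f : Mor X Z) (g : Mor Y Z) :
  exists (E : C) (x : Mor E X) (y : Mor E Y),
  [/\ (f ∘ x) + (g ∘ y) = 0,
      forall W (u : Mor W X) (v : Mor W Y), (f ∘ u) + (g ∘ v) = 0 ->
        exists2 w : Mor W E, x ∘ w = u & y ∘ w = v,
      forall W (w w' : Mor W E), x ∘ w = x ∘ w' -> y ∘ w = y ∘ w' -> w = w' &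
      epi f -> epi y].
Proof.
pose d := (f ∘ bpr1 ab X Y) + (g ∘ bpr2 ab X Y).
have kd := kermP ab d; pose k := kerm ab d.
have split_map W (w : Mor W (biprod ab X Y)) :
    w = (bin1 ab X Y ∘ bpr1 ab X Y ∘ w) + (bin2 ab X Y ∘ bpr2 ab X Y ∘ w).
  by rewrite !compA -compDl bin_pr comp1m.
exists (ker ab d), (bpr1 ab X Y ∘ k), (bpr2 ab X Y ∘ k); split.
- by rewrite !compA -compDl; exact: kd.1.
- move=> W u v e.
  pose w := (bin1 ab X Y ∘ u) + (bin2 ab X Y ∘ v).
  have w1 : bpr1 ab X Y ∘ w = u.
    by rewrite compDr (comprK (bpr1_in1 _ _ _)) compA bpr1_in2 comp0m addr0.
  have w2 : bpr2 ab X Y ∘ w = v.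
    by rewrite compDr (comprK (bpr2_in2 _ _ _)) compA bpr2_in1 comp0m add0r.
  have [|h hE] := ker_lift (g := w) kd; first by rewrite compDl -!compA w1 w2.
  by exists h; rewrite -compA -hE.
- move=> W w w'; rewrite -!compA => e1 e2; apply: (ker_mono kd).
  by rewrite [LHS]split_map [RHS]split_map e1 e2.
move=> ef.
have din1 : d ∘ bin1 ab X Y = f.
  by rewrite compDl -!compA bpr1_in1 bpr2_in1 compm0 compm1 addr0.
have ed : epi d.
  by apply: epiP => W w e; apply: (epi0 ef); rewrite -din1 compA e comp0m.
have [_ cd] := epi_ses ed kd.
apply: epiP => W t; rewrite compA => /(coker_lift cd) [u tu].
have u0 : u = 0.
  apply: (epi0 ef); rewrite -din1 compA -tu -compA bpr2_in1 compm0 //.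
by rewrite -[t]compm1 -(bpr2_in2 ab X Y) compA tu u0 !comp0m.
Qed.

(** An epimorphism is surjective on generalized elements [W -> Q], up to
    replacing [W] by a cover. *)
Lemma epi_lift Y Q W (q : Mor Y Q) (w : Mor W Q) : epi q ->
  exists (W' : C) (e : Mor W' W) (y : Mor W' Y), epi e /\ q ∘ y = w ∘ e.
Proof.
move=> eq; have [E [y [e [s _ _ ee]]]] := fiber_sum q (- w).
exists E, e, y; split; first exact: ee.
by apply/eqP; rewrite -subr_eq0 -compNl s.
Qed.

(** The image is the kernel of the cokernel. The corestriction [t] is epi: if
    [u ∘ t = 0] then [f] factors through the subobject [ker u] of the image;
    being the kernel of some [g], it contains the whole image, so [u = 0]. *)
Lemma image_fact X Y (f : Mor X Y) :
  exists (I : C) (s : Mor I Y) (t : Mor X I), [/\ mono s, epi t & f = s ∘ t].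
Proof.
have kc := kermP ab (cokerm ab f); have cf := cokermP ab f.
have [t tE] := ker_lift kc cf.1.
exists (ker ab (cokerm ab f)), (kerm ab (cokerm ab f)), t; split=> //.
  exact: ker_mono kc.
apply: epiP => W u ut; have ku := kermP ab u.
have [t' t'E] := ker_lift ku ut.
have [Z [g kg]] := mono_normal ab (mono_comp (ker_mono kc) (ker_mono ku)).
have gf : g ∘ f = 0 by rewrite tE t'E !compA -(compA g) kg.1 comp0m.
have [g' g'E] := coker_lift cf gf.
have [|r rE] := ker_lift (g := kerm ab (cokerm ab f)) kg.
  by rewrite g'E -compA kc.1 compm0.
have {}rE : idm _ = kerm ab u ∘ r.
  by apply: (ker_mono kc); rewrite compm1 [LHS]rE -compA.
by rewrite -[u]compm1 rE compA ku.1 comp0m.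
Qed.

Lemma simple_epi X T (f : Mor X T) : simple T -> f <> 0 -> epi f.
Proof.
move=> [_ sT] f0; have [I [s [t [ms et fE]]]] := image_fact f.
case: (sT _ _ ms) => [/zero_objectP I0 | /iso_epi es].
  by case: f0; rewrite fE -[s]compm1 I0 compm0 comp0m.
by rewrite fE; exact: epi_comp.
Qed.

(** Stated with arbitrary short exact sequences instead of chosen cokernels, so
    that no invariance under isomorphism has to be proved. *)
Inductive has_length : nat -> C -> Prop :=
| has_length0 X : zero_object X -> has_length 0 X
| has_lengthS n X Y T (i : Mor Y X) (p : Mor X T) :
    has_length n Y -> ses i p -> simple T -> has_length n.+1 X.

Lemma finite_length_has_length X : finite_length ab X -> exists n, has_length n X.
Proof.
elim=> [Y /has_length0 h | Z Y i _ [n ln] mi sT]; first by exists 0%N.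
by exists n.+1; apply: has_lengthS ln (mono_ses mi (cokermP ab i)) sT.
Qed.

(** Additivity of length, by induction on a composition series of [X] with last
    factor [T = X / Y]. If [S] maps to zero in [T] then [S] is a subobject of [Y]
    and [T] is also a factor of [Q = X / S], with [Y / S] below it. Otherwise [S]
    maps onto [T], so that [T] is a factor of [S], with [Y ∩ S] below it, and
    [Y / (Y ∩ S)] is [Q]. *)
Lemma has_length_ses n X S Q (s : Mor S X) (q : Mor X Q) : has_length n X -> ses s q ->
  exists a b, [/\ has_length a S, has_length b Q & (a + b = n)%N].
Proof.
move=> ln; elim: ln S Q s q => {n X} [X /zero_objectP X0 | n X Y T i p lY ih kip sT]
  S Q s q sq.
  exists 0%N, 0%N; split=> //; apply/has_length0/zero_objectP.
    by apply: (ker_mono sq.1); rewrite compm0 -[LHS]comp1m X0 comp0m.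
  by apply: (cok_epi sq.2); rewrite comp0m -[LHS]compm1 X0 compm0.
have [ps0|ps0] := classic (p ∘ s = 0).
  have [s1 s1E] := ker_lift kip.1 ps0.
  have ms1 : mono s1 by apply: (@mono_fact _ _ _ _ _ i); rewrite -s1E; exact: ker_mono sq.1.
  have c1 := cokermP ab s1.
  have [a [b [la lb abn]]] := ih _ _ _ _ (mono_ses ms1 c1).
  have [|m mE] := coker_lift (g := q ∘ i) c1.
    by rewrite -compA -s1E; exact: sq.2.1.
  have [r rE] := coker_lift sq.2 ps0.
  have er : epi r.
    by apply: epiP => W t tr; apply: (epi0 (cok_epi kip.2)); rewrite rE compA tr comp0m.
  exists a, b.+1; split=> //; last by rewrite addnS abn.
  apply: has_lengthS lb _ sT; apply: (mono_ses (s := m) (q := r)).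
    apply: monoP => W w mw.
    have [W' [e [y [ee ye]]]] := epi_lift w (cok_epi c1).
    have [|x xE] := ker_lift (g := i ∘ y) sq.1.
      by rewrite compA mE -compA ye compA mw comp0m.
    have yE : y = s1 ∘ x by apply: (ker_mono kip.1); rewrite xE s1E -compA.
    by apply: (epi0 ee); rewrite -ye yE compA c1.1 comp0m.
  apply: cokerI er _ _.
    by apply: (cok_epi c1); rewrite -compA -mE compA -rE kip.1.1 comp0m.
  move=> W t tm; have [|u uE] := coker_lift (g := t ∘ q) kip.2.
    by rewrite -compA mE compA tm comp0m.
  by exists u; apply: (cok_epi sq.2); rewrite uE rE compA.
have eps := simple_epi sT ps0.
have k := kermP ab (p ∘ s).
(* [j] is the inclusion of the intersection of [Y] and [S] into [Y]. *)
have [|j jE] := ker_lift (g := s ∘ kerm ab (p ∘ s)) kip.1; first by rewrite compA k.1.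
have mj : mono j.
  apply: (@mono_fact _ _ _ _ _ i); rewrite -jE.
  exact: mono_comp (ker_mono sq.1) (ker_mono k).
have sj : ses j (q ∘ i).
  apply: epi_ses.
    apply: epiP => W t; rewrite compA => /(coker_lift kip.2) [u uE].
    have u0 : u = 0 by apply: (epi0 eps); rewrite compA -uE -compA sq.1.1 compm0.
    by apply: (epi0 (cok_epi sq.2)); rewrite uE u0 comp0m.
  apply: kerI mj _ _; first by rewrite -compA -jE compA sq.1.1 comp0m.
  move=> W y; rewrite -compA => /(ker_lift sq.1) [x xE].
  have [|x' x'E] := ker_lift (g := x) k.
    by rewrite -compA -xE compA kip.1.1 comp0m.
  by exists x'; apply: (ker_mono kip.1); rewrite xE x'E compA jE -compA.
have [a [b [la lb abn]]] := ih _ _ _ _ sj.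
exists a.+1, b; split=> //; last by rewrite addSn abn.
exact: has_lengthS la (epi_ses eps k) sT.
Qed.

Lemma has_length_zero X : has_length 0 X -> zero_object X.
Proof. by move E: 0%N => n l; case: l E. Qed.

Lemma has_length_pos n X : has_length n X -> ~ zero_object X -> (0 < n)%N.
Proof. by case: n => // /has_length_zero. Qed.

End Abelian.

Definition abelian_op (K : fieldType) (C : lincat K) (ab : abelian C) :
    abelian (opcat C) :=
  @Abelian K (opcat C) (zero_ob ab)
    (let: conj a b := zero_obP ab in conj b a)
    (biprod ab) (bpr1 ab) (bpr2 ab) (bin1 ab) (bin2 ab)
    (bpr1_in1 ab) (bpr2_in2 ab) (bin_pr ab)
    (fun X Y f => coker ab (f : @Mor K C Y X))
    (fun X Y f => cokerm ab (f : @Mor K C Y X))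
    (fun X Y f => cokermP ab (f : @Mor K C Y X))
    (fun X Y f => ker ab (f : @Mor K C Y X))
    (fun X Y f => kerm ab (f : @Mor K C Y X))
    (fun X Y f => kermP ab (f : @Mor K C Y X))
    (fun X Y f => @epi_normal K C ab Y X f)
    (fun X Y f => @mono_normal K C ab Y X f).

(** Dual to the stability of epimorphisms under pullback. *)
Lemma pushout_mono (K : fieldType) (C : lincat K) (ab : abelian C) (X Y Z : C)
    (f : Mor Z X) (g : Mor Z Y) : mono f ->
  exists (P : C) (x : Mor X P) (y : Mor Y P),
  [/\ x ∘ f = y ∘ g,
      forall W (u : Mor X W) (v : Mor Y W), u ∘ f = v ∘ g ->
        exists2 w : Mor P W, w ∘ x = u & w ∘ y = v,
      forall W (w w' : Mor P W), w ∘ x = w' ∘ x -> w ∘ y = w' ∘ y -> w = w' &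
      mono y].
Proof.
move=> mf.
have [P [x [y [s u j m]]]] :=
  @fiber_sum K (opcat C) (abelian_op ab) X Y Z f (- g : @Mor K C Z Y).
exists P, x, y; split.
- by apply/eqP; rewrite -subr_eq0 -compNr; apply/eqP.
- by move=> W v w e; apply: u; rewrite /= compNr e subrr.
- exact: j.
exact: m.
Qed.

(** * Contraction with a pairing, and duality *)

Section Pairings.
Variables (K : fieldType) (C : moncat K).
Implicit Types X Y Z W P : C.

Lemma tensDm X X' Y Y' (f1 f2 : Mor X X') (g : Mor Y Y') :
  (f1 + f2) ⊗ₘ g = f1 ⊗ₘ g + f2 ⊗ₘ g.
Proof. by have := tensmPl 1 f1 f2 g; rewrite !scale1r. Qed.

Lemma run1 : run (munit C) = lun (munit C).
Proof.
apply: tensr1_inj; rewrite -triangle -lun_asc; congr (_ ∘ _).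
by rewrite -[RHS](comprK (lunK _)) -lun_nat (comprK (lunK _)).
Qed.

Lemma unit_coh X Y : (run X ⊗ₘ idm Y) ∘ asci X (munit C) Y = idm X ⊗ₘ lun Y.
Proof. by rewrite -triangle -compA asciK compm1. Qed.

Lemma asci_luni X Y : asci X (munit C) Y ∘ (idm X ⊗ₘ luni Y) = runi X ⊗ₘ idm Y.
Proof.
have e : (runi X ⊗ₘ idm Y) ∘ (run X ⊗ₘ idm Y) = idm _ by rewrite whr runK tensm1.
by rewrite -[LHS](comprK e) (compr1 (unit_coh _ _)) whl luniK tensm1 compm1.
Qed.

Lemma asc_runi X Y : asc X Y (munit C) ∘ runi (X ⊗ Y) = idm X ⊗ₘ runi Y.
Proof.
have e : (idm X ⊗ₘ runi Y) ∘ (idm X ⊗ₘ run Y) = idm _.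
  by rewrite whl runK tensm1.
by rewrite -[LHS](comprK e) (compA (idm X ⊗ₘ run Y)) run_asc runiK compm1.
Qed.

Lemma asc_luni X Y : asc (munit C) X Y ∘ (luni X ⊗ₘ idm Y) = luni (X ⊗ Y).
Proof.
rewrite -[LHS](comprK (lunK _)) (compA (lun _)) lun_asc whr luniK tensm1.
by rewrite compm1.
Qed.

Lemma zero_left_dual X : zero_object X -> left_dual X X.
Proof.
move=> /zero_objectP X0; exists 0, 0.
by split; rewrite -[LHS]compm1 X0 compm0.
Qed.

(** Duals are handled through the map that contracts the last factor of
    [P ⊗ Y] against [X] by means of a pairing [g]: it is natural in everything,
    and it is bijective when [g] is an evaluation, so associators rarely show up
    outside of this section. It is locked because its body is a composition,
    which rewriting with associativity would otherwise open. *)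
Fact contract_key : unit. Proof. by []. Qed.
Definition contract P X Y W (g : Mor (Y ⊗ X) (munit C)) (h : Mor W (P ⊗ Y)) :
    Mor (W ⊗ X) P :=
  locked_with contract_key (run P ∘ (idm P ⊗ₘ g) ∘ asc P Y X ∘ (h ⊗ₘ idm X)).

Lemma contractE P X Y W (g : Mor (Y ⊗ X) (munit C)) (h : Mor W (P ⊗ Y)) :
  contract g h = run P ∘ (idm P ⊗ₘ g) ∘ asc P Y X ∘ (h ⊗ₘ idm X).
Proof. by rewrite /contract unlock. Qed.

Lemma contract_natl P X Y W W' (g : Mor (Y ⊗ X) (munit C)) (h : Mor W (P ⊗ Y))
    (w : Mor W' W) : contract g (h ∘ w) = contract g h ∘ (w ⊗ₘ idm X).
Proof. by rewrite !contractE -!compA whr. Qed.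

Lemma contract_natr P P' X Y W (g : Mor (Y ⊗ X) (munit C)) (h : Mor W (P ⊗ Y))
    (f : Mor P P') : contract g ((f ⊗ₘ idm Y) ∘ h) = f ∘ contract g h.
Proof.
rewrite !contractE -whr (compr2 (asc_whr _ _ _)) -(compr2 (xch _ _)).
by rewrite (compr2 (run_nat f)).
Qed.

Lemma contract_mid P X Y Y' W (g : Mor (Y ⊗ X) (munit C)) (h : Mor W (P ⊗ Y'))
    (f : Mor Y' Y) : contract g ((idm P ⊗ₘ f) ∘ h) = contract (g ∘ (f ⊗ₘ idm X)) h.
Proof.
by rewrite !contractE -whr (compr2 (asc_nat _ _ _)) (compr1 (whl _ _ _)).
Qed.

Lemma contract_right P X X' Y W (g : Mor (Y ⊗ X) (munit C)) (h : Mor W (P ⊗ Y))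
    (f : Mor X' X) : contract (g ∘ (idm Y ⊗ₘ f)) h = contract g h ∘ (idm W ⊗ₘ f).
Proof.
by rewrite !contractE -!compA xch (compr2 (asc_whl _ _ _)) (compr1 (whl _ _ _)).
Qed.

Lemma contract_luni X Y W (g : Mor (Y ⊗ X) (munit C)) (f : Mor W Y) :
  contract g (luni Y ∘ f) = g ∘ (f ⊗ₘ idm X).
Proof.
rewrite contract_natl; congr (_ ∘ _); rewrite !contractE asc_luni run1 (compr2 (lun_nat g)).
by rewrite luniK compm1.
Qed.

Lemma contract_whisk P X Y Z W (g : Mor (Y ⊗ X) (munit C)) (h : Mor W (P ⊗ Y)) :
  contract g (asci Z P Y ∘ (idm Z ⊗ₘ h)) = (idm Z ⊗ₘ contract g h) ∘ asc Z W X.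
Proof.
rewrite !contractE -run_asc -whr -!whl -!compA (compr2 (asc_whl _ _ _)).
by rewrite -(asc_nat (idm Z) h (idm X)) (compr2 (pentD _ _ _ _)) -!compA
  (comprK (asciK _ _ _)).
Qed.

Lemma contractD P X Y W (g : Mor (Y ⊗ X) (munit C)) (h1 h2 : Mor W (P ⊗ Y)) :
  contract g (h1 + h2) = contract g h1 + contract g h2.
Proof. by rewrite !contractE tensDm !compDr. Qed.

Lemma contract0 P X Y W (g : Mor (Y ⊗ X) (munit C)) : contract g (0 : Mor W (P ⊗ Y)) = 0.
Proof. by rewrite !contractE tens0m !compm0. Qed.

Lemma contractB P X Y W (g : Mor (Y ⊗ X) (munit C)) (h1 h2 : Mor W (P ⊗ Y)) :
  contract g (h1 - h2) = contract g h1 - contract g h2.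
Proof. by rewrite !contractE tensBm !compBr. Qed.

Lemma luni_inj X W (f f' : Mor W X) : luni X ∘ f = luni X ∘ f' -> f = f'.
Proof. by move=> e; rewrite -[f](comprK (luniK X)) e (comprK (luniK X)). Qed.

Section Dual.
Variables (X Y : C) (ev : Mor (Y ⊗ X) (munit C)) (coev : Mor (munit C) (X ⊗ Y)).
Hypothesis dXY : duality ev coev.

Definition curry P W (f : Mor (W ⊗ X) P) : Mor W (P ⊗ Y) :=
  (f ⊗ₘ idm Y) ∘ asci W X Y ∘ (idm W ⊗ₘ coev) ∘ runi W.

Lemma contract_coev : contract ev coev = lun X.
Proof. by rewrite -[RHS]comp1m -dXY.1 !contractE -!compA lunK compm1. Qed.

Lemma curryK P W (f : Mor (W ⊗ X) P) : contract ev (curry f) = f.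
Proof.
rewrite /curry contract_natr compA contract_natl contract_whisk contract_coev triangle.
by rewrite whr runiK tensm1 compm1.
Qed.

Lemma curry_ev : curry ev = luni Y.
Proof. by rewrite -[RHS]compm1 -dXY.2 (comprK (lunK _)). Qed.

Lemma curry_natl P W W' (f : Mor (W ⊗ X) P) (w : Mor W' W) :
  curry (f ∘ (w ⊗ₘ idm X)) = curry f ∘ w.
Proof.
rewrite /curry -whr -!compA -(compr2 (asci_whr _ _ _)) (compr2 (xch _ _)).
by rewrite runi_nat.
Qed.

Lemma curry_natr P P' W (f : Mor (W ⊗ X) P) (p : Mor P P') :
  curry (p ∘ f) = (p ⊗ₘ idm Y) ∘ curry f.
Proof. by rewrite /curry -whr -!compA. Qed.

Lemma curry_whisk P W Z (f : Mor (W ⊗ X) P) :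
  curry ((idm Z ⊗ₘ f) ∘ asc Z W X) = asci Z P Y ∘ (idm Z ⊗ₘ curry f).
Proof.
rewrite /curry -!whl -whr -!compA (compr2 (pentE _ _ _ _)) -!compA.
rewrite (compr2 (asc_whl _ _ _)) asc_runi.
by rewrite (compr2 (asci_nat _ _ _)).
Qed.

Lemma contractK P W (h : Mor W (P ⊗ Y)) : curry (contract ev h) = h.
Proof.
rewrite -[h]comp1m contract_natl curry_natl; congr (_ ∘ _).
rewrite !contractE tensm1 compm1 curry_natr curry_whisk curry_ev.
by rewrite (compr1 (unit_coh _ _)) whl luniK tensm1.
Qed.

Lemma contract_inj P W (h h' : Mor W (P ⊗ Y)) : contract ev h = contract ev h' -> h = h'.
Proof. by move=> e; rewrite -(contractK h) e contractK. Qed.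

End Dual.

(** The second zigzag holds for free when the contraction is injective, since its
    contraction is [g] by the first zigzag. *)
Lemma dualityI X Y (g : Mor (Y ⊗ X) (munit C)) (t : Mor (munit C) (X ⊗ Y)) :
  (forall h h' : Mor Y (munit C ⊗ Y), contract g h = contract g h' -> h = h') ->
  contract g t = lun X -> duality g t.
Proof.
move=> inj e; split.
  rewrite -[RHS](luniK X) -e !contractE -!compA //.
set z := (_ ∘ _); have : luni Y ∘ z = luni Y; last first.
  by move=> ez; rewrite -[LHS](comprK (luniK Y)) ez luniK.
apply: inj; rewrite /z (comprK (lunK _)).
rewrite contract_natr compA contract_natl contract_whisk e triangle whr runiK tensm1 compm1.
by rewrite -[luni Y]compm1 contract_luni tensm1 compm1.
Qed.

(** [N ⊗ -] is a right adjoint as soon as [N] has a left dual: [th] is the counit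
    and [thK] one of the triangle identities. *)
Lemma tens_dual_mono (N N' U V : C) (m : Mor U V) :
  left_dual N N' -> mono m -> mono (idm N ⊗ₘ m).
Proof.
move=> [ev [coev [zig _]]] mm.
pose th Z : Mor (N' ⊗ (N ⊗ Z)) Z := lun Z ∘ (ev ⊗ₘ idm Z) ∘ asci N' N Z.
have thN Z Z' (f : Mor Z Z') : th Z' ∘ (idm N' ⊗ₘ (idm N ⊗ₘ f)) = f ∘ th Z.
  rewrite /th -!compA asci_whl (compr2 (xch _ _)).
  by rewrite (compr2 (lun_nat f)).
have thK Z : (idm N ⊗ₘ th Z) ∘ asc N N' (N ⊗ Z) ∘ (coev ⊗ₘ idm (N ⊗ Z))
    ∘ luni (N ⊗ Z) = idm (N ⊗ Z).
  have /(congr1 (fun u : Mor N N => @tensm K C _ _ _ _ u (idm Z))) := zig.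
  rewrite tensm1 => zigZ; rewrite -[RHS]zigZ.
  rewrite -!whr -asc_luni -(compr2 (asc_whr _ _ _)) -triangle /th -!whl -!compA.
  by rewrite (compr2 (asc_nat _ ev _)) (compr2 (pentB _ _ _ _)) -!compA.
apply: monoP => W w e.
have e0 : th U ∘ (idm N' ⊗ₘ w) = 0.
  by apply: (mono0 mm); rewrite -(compr2 (thN _ _ _)) whl e tensm0 compm0.
rewrite -[w](comprK (thK U)) -!compA luni_nat (compr2 (xch _ _)).
by rewrite (compr2 (asc_whl _ _ _)) (compr1 (whl _ _ _)) e0 tensm0 comp0m.
Qed.

End Pairings.

(** * Left duals of extensions *)

Section Extension.
Variables (K : fieldType) (C : moncat K) (ab : abelian C).
Hypothesis rexl : forall X U V Q (f : Mor U V) (q : Mor V Q),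
  is_cokernel f q -> is_cokernel (C := C) (f ⊗ₘ idm X) (q ⊗ₘ idm X).
Hypothesis rexr : forall X U V Q (f : Mor U V) (q : Mor V Q),
  is_cokernel f q -> is_cokernel (C := C) (idm X ⊗ₘ f) (idm X ⊗ₘ q).
Implicit Types X Y Z W P : C.

Lemma rexl_epi X Y Z (q : Mor X Y) : epi q -> epi (q ⊗ₘ idm Z).
Proof. by move=> /(epi_normal ab) [W [g /(rexl Z) /cok_epi]]. Qed.

Lemma rexr_epi X Y Z (q : Mor X Y) : epi q -> epi (idm Z ⊗ₘ q).
Proof. by move=> /(epi_normal ab) [W [g /(rexr Z) /cok_epi]]. Qed.

Section Sequence.
Variables (L M R : C) (i : Mor L M) (q : Mor M R).
Hypothesis iq : ses i q.
Variables (L' R' : C) (evL : Mor (L' ⊗ L) (munit C)) (evR : Mor (R' ⊗ R) (munit C)).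
Variables (coL : Mor (munit C) (L ⊗ L')) (coR : Mor (munit C) (R ⊗ R')).
Hypotheses (dL : duality evL coL) (dR : duality evR coR).
Hypothesis flatL' : forall U V (m : Mor U V), mono m -> mono (idm L' ⊗ₘ m).

Let eq : epi q := cok_epi iq.2.

(** The pushout [P] of [evL] and [L' ⊗ i] is an extension of [L' ⊗ R] by the unit.
    It is the obstruction to extending [evL] along [i]: a morphism
    [y : W -> L'] lifts to a pairing of [W] with [M] exactly when the pullback of
    this extension along [y ⊗ R] splits. *)
Lemma extension_pushout : exists (P : C) (a : Mor (munit C) P) (p : Mor P (L' ⊗ R))
    (r : Mor (L' ⊗ M) P),
  [/\ ses a p, r ∘ (idm L' ⊗ₘ i) = a ∘ evL & p ∘ r = idm L' ⊗ₘ q].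
Proof.
have cq := rexr L' iq.2.
have mi : mono (idm L' ⊗ₘ i) := flatL' (ker_mono iq.1).
have [P [r [a [ra u j ma]]]] := pushout_mono ab evL mi.
have [|p pr pa] := u _ (idm L' ⊗ₘ q) 0; first by rewrite comp0m; exact: cq.1.
exists P, a, p, r; split=> //; apply: (mono_ses ab) ma _; apply: cokerI => //.
  apply: epiP => W w wp; apply: (epi0 (cok_epi cq)).
  by rewrite -pr compA wp comp0m.
move=> W t ta; have [|s sE] := coker_lift (g := t ∘ r) cq.
  by rewrite -compA ra compA ta comp0m.
exists s; apply: j; first by rewrite sE -pr compA.
by rewrite -compA pa compm0.
Qed.

(** The dual of [M] represents the pairs of [y : W -> L'] and [u : W ⊗ R -> P]
    with [p ∘ u = - (y ⊗ R)], that is, the morphisms to [L'] together with a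
    splitting as above. It exists because [R] has a dual, so that the morphisms
    [W ⊗ R -> P] are those from [W] to [P ⊗ R']; and it maps onto [L'] because
    [p ⊗ R'] is epi. The two composites [E ⊗ M -> P] through [L' ⊗ M] and
    [E ⊗ R] have a sum killed by [p], which defines the pairing [g]. *)
Lemma extension_pairing : exists (E : C) (g : Mor (E ⊗ M) (munit C))
    (k : Mor R' E) (y : Mor E L'),
  [/\ ses k y, g ∘ (idm E ⊗ₘ i) = evL ∘ (y ⊗ₘ idm L) &
      g ∘ (k ⊗ₘ idm M) = evR ∘ (idm R' ⊗ₘ q)].
Proof.
have [P [a [p [r [sap ri pr]]]]] := extension_pushout.
pose eta : Mor L' (L' ⊗ R ⊗ R') := curry coR (idm (L' ⊗ R)).
have etaE W (w : Mor W L') : contract evR (eta ∘ w) = w ⊗ₘ idm R.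
  by rewrite contract_natl (curryK dR) comp1m.
have [E [x [y [xy uE jE ey]]]] := fiber_sum ab (p ⊗ₘ idm R') eta.
pose u := contract evR x.
have pu : p ∘ u = - (y ⊗ₘ idm R).
  rewrite -contract_natr -etaE; apply/eqP; rewrite -addr_eq0 -contractD; apply/eqP.
  by rewrite xy contract0.
have {}ey : epi y by apply: ey; apply: rexl_epi; exact: cok_epi sap.2.
have [g gE] : exists g, (r ∘ (y ⊗ₘ idm M)) + (u ∘ (idm E ⊗ₘ q)) = a ∘ g.
  apply: (ker_lift sap.1); rewrite compDr (compr1 pr) trl (compr1 pu) compNl tlr.
  by rewrite subrr.
have ma := ker_mono sap.1.
(* [R'] is the part of [E] with [y = 0] and [u] in the image of [a]. *)
have [|k xk yk] := uE R' (curry coR (a ∘ evR)) 0.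
  apply: (contract_inj dR); rewrite compm0 addr0 contract_natr (curryK dR) compA sap.1.1.
  by rewrite comp0m contract0.
have uk : u ∘ (k ⊗ₘ idm R) = a ∘ evR by rewrite -contract_natl xk (curryK dR).
have gk : g ∘ (k ⊗ₘ idm M) = evR ∘ (idm R' ⊗ₘ q).
  apply: ma; rewrite compA -gE compDl -!compA whr yk tens0m compm0 add0r.
  by rewrite -xch (compr2 uk).
exists E, g, k, y; split=> //.
  apply: (epi_ses ab ey); apply: (kerI _ yk).
    apply: monoP => W w kw; apply/luni_inj/(contract_inj dR).
    rewrite compm0 contract0 contract_luni; apply: (rexr_epi (Z := W) eq).
    by rewrite comp0m -compA xch compA -gk -compA whr kw tens0m compm0.
  move=> W w yw.
  have puw : p ∘ contract evR (x ∘ w) = 0.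
    by rewrite contract_natl (compr1 pu) compNl whr yw tens0m oppr0.
  have [v vE] := ker_lift sap.1 puw.
  exists (lun R' ∘ curry coR v); apply: jE.
    rewrite compA xk; apply: (contract_inj dR); rewrite vE contract_natl (curryK dR) -compA.
    by rewrite -contract_luni (comprK (lunK _)) (curryK dR).
  by rewrite yw compA yk comp0m.
apply: ma; rewrite compA -gE compDl -!compA !whl iq.1.1 tensm0 compm0 addr0.
by rewrite xch (compr2 ri).
Qed.

(** A five lemma for contractions. Those with [evL] and [evR] are bijective and
    [E] is an extension of [L'] by [R'], so the contraction with the pairing of [E]
    and [M] is injective, and surjective up to a cover of the source. By
    injectivity a preimage on a cover descends. *)
Lemma left_dual_extension : exists E, left_dual M E.
Proof.
have [E [g [k [y [ky gi gk]]]]] := extension_pairing.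
have shk Z W (h : Mor W (Z ⊗ R')) :
    contract g ((idm Z ⊗ₘ k) ∘ h) = contract evR h ∘ (idm W ⊗ₘ q).
  by rewrite contract_mid gk contract_right.
have shi Z W (h : Mor W (Z ⊗ E)) :
    contract g h ∘ (idm W ⊗ₘ i) = contract evL ((idm Z ⊗ₘ y) ∘ h).
  by rewrite contract_mid -gi contract_right.
have kinj Z W (h : Mor W (Z ⊗ R')) : contract g ((idm Z ⊗ₘ k) ∘ h) = 0 -> h = 0.
  rewrite shk => e; apply: (contract_inj dR); rewrite contract0.
  exact: (epi0 (rexr_epi (Z := W) eq)).
have kyZ Z : ses (idm Z ⊗ₘ k) (idm Z ⊗ₘ y).
  apply: (mono_ses ab); last exact: rexr ky.2.
  by apply: monoP => W w e; apply: kinj; rewrite e contract0.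
have ginj Z W (h : Mor W (Z ⊗ E)) : contract g h = 0 -> h = 0.
  move=> e; have yh : (idm Z ⊗ₘ y) ∘ h = 0.
    by apply: (contract_inj dL); rewrite -shi e comp0m contract0.
  have [h' hE] := ker_lift (kyZ Z).1 yh.
  by rewrite hE (kinj _ _ h') ?compm0 // -hE.
pose f : Mor (munit C ⊗ M) M := lun M.
(* [h1] has the right contraction on [L]; adding an element of [R'] corrects it
   on [M]. *)
have [W [e [h1 [ee h1E]]]] :=
  epi_lift ab (curry coL (f ∘ (idm _ ⊗ₘ i))) (cok_epi (kyZ M).2).
have [|d dE] := coker_lift (g := (f ∘ (e ⊗ₘ idm M)) - contract g h1) (rexr W iq.2).
  rewrite compBl shi h1E contract_natl (curryK dL) -!compA xch.
  by rewrite subrr.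
pose h2 := h1 + ((idm M ⊗ₘ k) ∘ curry coR d).
have h2E : contract g h2 = f ∘ (e ⊗ₘ idm M).
  by rewrite contractD shk (curryK dR) -dE addrC subrK.
have ke := kermP ab e.
have [|t tE] := coker_lift (g := h2) (epi_ses ab ee ke).2.
  apply: ginj; rewrite contract_natl h2E -compA whr ke.1 tens0m compm0 //.
exists E, g, t; apply: dualityI.
  move=> h h' /eqP; rewrite -subr_eq0 -contractB => /eqP /ginj /eqP.
  by rewrite subr_eq0 => /eqP.
apply: (rexl_epi (Z := M) ee); rewrite -contract_natl -tE h2E //.
Qed.

End Sequence.
End Extension.

(** * The abelian category of modules, and its dualizable objects *)

Section ModuleCategory.
Variables (K : fieldType) (C : moncat K) (ab : abelian C) (c : braiding C).
Variables (D : r_structure C) (A : comm_algebra c).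
Notation lmod := (lmod A).
Implicit Types (X Y Z : C) (M N P Q : lmod).

Let tlepi X Y Z (q : Mor X Y) : epi q -> epi (q ⊗ₘ idm Z) := @tensl_epi K C ab D X Y Z q.
Let trepi X Y Z (q : Mor X Y) : epi q -> epi (idm Z ⊗ₘ q) := @tensr_epi K C ab c D X Y Z q.

Lemma hom_lift_mono M N W (k : lmod_hom N M) (g : lmod_hom W M) (h : Mor W N) :
  mono (vsval k) -> vsval g = vsval k ∘ h -> h ∘ mact W = mact N ∘ (idm A ⊗ₘ h).
Proof.
move=> mk e; apply: mk; rewrite compA -e lmod_homP e -whl.
by rewrite (compr2 (lmod_homP k)).
Qed.

Lemma hom_lift_epi M N W (q : lmod_hom M N) (g : lmod_hom M W) (h : Mor N W) :
  epi (vsval q) -> vsval g = h ∘ vsval q -> h ∘ mact N = mact W ∘ (idm A ⊗ₘ h).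
Proof.
move=> eq e; apply: (trepi (Z := A) eq); rewrite -!compA -lmod_homP whl -e compA -e.
exact: lmod_homP.
Qed.

Lemma mono_sub_module M (S : C) (s : Mor S M) : mono s ->
  (exists a : Mor (A ⊗ S) S, s ∘ a == mact M ∘ (idm A ⊗ₘ s)) ->
  {a : Mor (A ⊗ S) S | [/\ s ∘ a = mact M ∘ (idm A ⊗ₘ s),
    a ∘ (amul A ⊗ₘ idm S) = a ∘ (idm A ⊗ₘ a) ∘ asc A A S &
    a ∘ (aone A ⊗ₘ idm S) = lun S]}.
Proof.
move=> ms ex; have aE := eqP (xchooseP ex); set a := xchoose ex in aE.
exists a; split=> //; apply: ms.
  rewrite (compr2 aE) -xch (compr1 (mactA M)) -!compA asc_whl (compr2 aE).
  by rewrite !(compr1 (whl _ _ _)) aE.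
by rewrite (compr2 aE) -xch (compr1 (mact1 M)) lun_nat.
Qed.

Lemma epi_quotient_module M (Q : C) (q : Mor M Q) : epi q ->
  (exists a : Mor (A ⊗ Q) Q, a ∘ (idm A ⊗ₘ q) == q ∘ mact M) ->
  {a : Mor (A ⊗ Q) Q | [/\ a ∘ (idm A ⊗ₘ q) = q ∘ mact M,
    a ∘ (amul A ⊗ₘ idm Q) = a ∘ (idm A ⊗ₘ a) ∘ asc A A Q &
    a ∘ (aone A ⊗ₘ idm Q) = lun Q]}.
Proof.
move=> eq ex; have aE := eqP (xchooseP ex); set a := xchoose ex in aE.
exists a; split=> //.
  apply: (trepi (Z := A ⊗ A) eq); rewrite -!compA xch (compr2 aE) mactA.
  by rewrite asc_whl (compr1 (whl _ _ _)) aE -whl -!compA (compr2 aE).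
apply: (trepi (Z := munit C) eq); rewrite -!compA xch (compr2 aE) mact1.
by rewrite lun_nat.
Qed.

Lemma lmod_kernel M N (f : lmod_hom M N) :
  {N' : lmod & {k : lmod_hom N' M |
    is_kernel (C := lmod_cat A) k f /\ is_kernel (vsval k) (vsval f)}}.
Proof.
have kf := kermP ab (vsval f); have mk := ker_mono kf.
have [|a [aE aA a1]] := mono_sub_module (M := M) mk.
  have [|a aE] := ker_lift (g := mact M ∘ (idm A ⊗ₘ kerm ab (vsval f))) kf.
    by rewrite compA lmod_homP -compA whl kf.1 tensm0 compm0.
  by exists a; rewrite aE.
exists (Lmod aA a1), (@lmod_mk _ _ _ (Lmod aA a1) M _ aE); split=> //.
apply: kerI.
- by move=> W g h /(congr1 val) e; apply/lmod_inj/mk.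
- by apply/lmod_inj; exact: kf.1.
move=> W g /(congr1 val) /(ker_lift kf) [h hE].
exists (lmod_mk (@hom_lift_mono _ (Lmod aA a1) _
  (@lmod_mk _ _ _ (Lmod aA a1) M _ aE) g h mk hE)).
exact/lmod_inj.
Qed.

Lemma lmod_cokernel M N (f : lmod_hom M N) :
  {Q : lmod & {q : lmod_hom N Q |
    is_cokernel (C := lmod_cat A) f q /\ is_cokernel (vsval f) (vsval q)}}.
Proof.
have cf := cokermP ab (vsval f); have eq := cok_epi cf.
have [|a [aE aA a1]] := epi_quotient_module (M := N) eq.
  have [|a aE] := coker_lift (g := cokerm ab (vsval f) ∘ mact N) (tensr_coker D c A cf).
    by rewrite -compA -lmod_homP compA cf.1 comp0m.
  by exists a; rewrite -aE.
exists (Lmod aA a1), (@lmod_mk _ _ _ N (Lmod aA a1) _ (esym aE)); split=> //.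
apply: cokerI.
- by move=> W g h /(congr1 val) e; apply/lmod_inj/eq.
- by apply/lmod_inj; exact: cf.1.
move=> W g /(congr1 val) /(coker_lift cf) [h hE].
exists (lmod_mk (@hom_lift_epi _ (Lmod aA a1) _
  (@lmod_mk _ _ _ N (Lmod aA a1) _ (esym aE)) g h eq hE)).
exact/lmod_inj.
Qed.

(** The kernel of [f] as a module morphism, which is zero, is also its kernel in
    the base category. *)
Lemma val_mono M N (f : lmod_hom M N) : mono (C := lmod_cat A) f -> mono (vsval f).
Proof.
move=> mf; have [N' [k [k0 kf]]] := lmod_kernel f.
have e0 : k = 0 by apply: (@mono0 _ (lmod_cat A) _ _ _ f k mf k0.1).
apply: monoP => W w /(ker_lift kf) [h ->].
by rewrite e0 comp0m.
Qed.

Lemma val_epi M N (f : lmod_hom M N) : epi (C := lmod_cat A) f -> epi (vsval f).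
Proof.
move=> ef; have [N' [q [q0 qf]]] := lmod_cokernel f.
have e0 : q = 0 by apply: (@epi0 _ (lmod_cat A) _ _ _ f q ef q0.1).
apply: epiP => W w /(coker_lift qf) [h ->].
by rewrite e0 compm0.
Qed.

Lemma lmod_biproduct M N : {B : lmod & {p : lmod_hom M B * lmod_hom N B *
    (lmod_hom B M * lmod_hom B N) |
  [/\ lmod_comp p.2.1 p.1.1 = lmod_id M, lmod_comp p.2.2 p.1.2 = lmod_id N &
     lmod_comp p.1.1 p.2.1 + lmod_comp p.1.2 p.2.2 = lmod_id B]}}.
Proof.
pose i1 := bin1 ab M N; pose i2 := bin2 ab M N.
pose p1 := bpr1 ab M N; pose p2 := bpr2 ab M N.
pose a := (i1 ∘ mact M ∘ (idm A ⊗ₘ p1)) + (i2 ∘ mact N ∘ (idm A ⊗ₘ p2)).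
have p1a : p1 ∘ a = mact M ∘ (idm A ⊗ₘ p1).
  by rewrite compDr (comprK (bpr1_in1 _ _ _)) (compr1 (bpr1_in2 _ _ _)) comp0m addr0.
have p2a : p2 ∘ a = mact N ∘ (idm A ⊗ₘ p2).
  by rewrite compDr (comprK (bpr2_in2 _ _ _)) (compr1 (bpr2_in1 _ _ _)) comp0m add0r.
have ext W (f g : Mor W (biprod ab M N)) : p1 ∘ f = p1 ∘ g -> p2 ∘ f = p2 ∘ g -> f = g.
  by move=> e1 e2; rewrite -[f]comp1m -[g]comp1m -bin_pr !compDl -!compA e1 e2.
have aA : a ∘ (amul A ⊗ₘ idm _) = a ∘ (idm A ⊗ₘ a) ∘ asc A A _.
  apply: ext.
    rewrite (compr2 p1a) -xch (compr1 (mactA M)) -!compA asc_whl (compr2 p1a).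
    by rewrite !(compr1 (whl _ _ _)) p1a.
  rewrite (compr2 p2a) -xch (compr1 (mactA N)) -!compA asc_whl (compr2 p2a).
  by rewrite !(compr1 (whl _ _ _)) p2a.
have a1 : a ∘ (aone A ⊗ₘ idm _) = lun _.
  apply: ext; first by rewrite (compr2 p1a) -xch (compr1 (mact1 M)) lun_nat.
  by rewrite (compr2 p2a) -xch (compr1 (mact1 N)) lun_nat.
pose B := Lmod aA a1.
have h1 : i1 ∘ mact M = mact B ∘ (idm A ⊗ₘ i1).
  rewrite /= compDl -!compA !whl bpr1_in1 bpr2_in1 tensm0 tensm1 !compm0.
  by rewrite compm1 addr0.
have h2 : i2 ∘ mact N = mact B ∘ (idm A ⊗ₘ i2).
  rewrite /= compDl -!compA !whl bpr1_in2 bpr2_in2 tensm0 tensm1 !compm0.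
  by rewrite compm1 add0r.
exists B, (@lmod_mk _ _ _ M B _ h1, @lmod_mk _ _ _ N B _ h2,
  (@lmod_mk _ _ _ B M _ p1a, @lmod_mk _ _ _ B N _ p2a)).
by split; apply: lmod_inj; [exact: bpr1_in1 | exact: bpr2_in2 | exact: bin_pr].
Qed.

Lemma lmod_zero : {Z : lmod | zero_object (C := lmod_cat A) Z}.
Proof.
have /zero_objectP Z0 := zero_obP ab.
have uniq W (f g : Mor W (zero_ob ab)) : f = g.
  by rewrite -[f]comp1m -[g]comp1m Z0 !comp0m.
exists (Lmod (uniq _ (0 ∘ (amul A ⊗ₘ idm (zero_ob ab))) _) (uniq _ (0 ∘ _) _)).
by apply/zero_objectP/lmod_inj; exact: uniq.
Qed.

Lemma lmod_mono_normal M N (f : lmod_hom M N) : mono (C := lmod_cat A) f ->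
  exists (Z : lmod) (g : lmod_hom N Z), is_kernel (C := lmod_cat A) f g.
Proof.
move=> mf; have mv := val_mono mf; have [Q [q [q0 qf]]] := lmod_cokernel f.
exists Q, q; have [k _] := mono_ses ab mv qf.
apply: kerI => //; first exact: q0.1.
move=> W g /(congr1 val) /(ker_lift k) [h hE].
by exists (lmod_mk (hom_lift_mono mv hE)); apply/lmod_inj.
Qed.

Lemma lmod_epi_normal M N (f : lmod_hom M N) : epi (C := lmod_cat A) f ->
  exists (Z : lmod) (g : lmod_hom Z M), is_cokernel (C := lmod_cat A) g f.
Proof.
move=> ef; have ev := val_epi ef; have [Q [q [q0 qf]]] := lmod_kernel f.
exists Q, q; have [_ k] := epi_ses ab ev qf.
apply: cokerI => //; first exact: q0.1.
move=> W g /(congr1 val) /(coker_lift k) [h hE].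
by exists (lmod_mk (hom_lift_epi ev hE)); apply/lmod_inj.
Qed.

Definition lmod_abelian : abelian (lmod_cat A) :=
  @Abelian K (lmod_cat A) (sval lmod_zero) (svalP lmod_zero)
    (fun M N => projT1 (lmod_biproduct M N))
    (fun M N => (sval (projT2 (lmod_biproduct M N))).1.1)
    (fun M N => (sval (projT2 (lmod_biproduct M N))).1.2)
    (fun M N => (sval (projT2 (lmod_biproduct M N))).2.1)
    (fun M N => (sval (projT2 (lmod_biproduct M N))).2.2)
    (fun M N => let: And3 e _ _ := svalP (projT2 (lmod_biproduct M N)) in e)
    (fun M N => let: And3 _ e _ := svalP (projT2 (lmod_biproduct M N)) in e)
    (fun M N => let: And3 _ _ e := svalP (projT2 (lmod_biproduct M N)) in e)
    (fun M N f => projT1 (lmod_kernel f))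
    (fun M N f => sval (projT2 (lmod_kernel f)))
    (fun M N f => (svalP (projT2 (lmod_kernel f))).1)
    (fun M N f => projT1 (lmod_cokernel f))
    (fun M N f => sval (projT2 (lmod_cokernel f)))
    (fun M N f => (svalP (projT2 (lmod_cokernel f))).1)
    lmod_mono_normal lmod_epi_normal.

Lemma val_cokernel L M Q (f : lmod_hom L M) (q : lmod_hom M Q) :
  is_cokernel (C := lmod_cat A) f q -> is_cokernel (vsval f) (vsval q).
Proof.
move=> ck; have [Q' [q' [cq' vq']]] := lmod_cokernel f.
have [u [v [vu uv]] uq] := coker_uniq cq' ck.
have uq' : vsval u ∘ vsval q' = vsval q by rewrite -uq.
have vuE : vsval v ∘ vsval u = idm Q' by have := congr1 val vu.
apply: cokerI.
- apply: val_epi; exact: (cok_epi ck).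
- by have /(congr1 val) := ck.1.
move=> W g /(coker_lift vq') [h hE].
by exists (h ∘ vsval v); rewrite -uq' -compA (comprK vuE).
Qed.

Lemma cokernel_val L M Q (f : lmod_hom L M) (q : lmod_hom M Q) :
  is_cokernel (vsval f) (vsval q) -> is_cokernel (C := lmod_cat A) f q.
Proof.
move=> cq; have eq := cok_epi cq; apply: cokerI.
- by move=> W g h /(congr1 val) e; apply/lmod_inj/eq.
- by apply/lmod_inj; exact: cq.1.
move=> W g /(congr1 val) /(coker_lift cq) [h hE].
by exists (lmod_mk (hom_lift_epi eq hE)); apply/lmod_inj.
Qed.

Lemma val_ses L M Q (f : lmod_hom L M) (q : lmod_hom M Q) :
  ses (C := lmod_cat A) f q -> ses (vsval f) (vsval q).
Proof.
case=> k ck; apply: (mono_ses ab); last exact: val_cokernel.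
apply: val_mono; exact: (ker_mono k).
Qed.

(** The projection [M ⊗ P -> M ⊗_A P] is natural and epi, so a morphism out of
    [M ⊗_A P] that vanishes on [L] comes from [Q ⊗ P] by right exactness in the
    base category; it is balanced because it is so after the epi
    [M ⊗ A ⊗ P -> Q ⊗ A ⊗ P]. *)
Lemma mtensm_rexl P L M Q (f : lmod_hom L M) (q : lmod_hom M Q) :
  is_cokernel (C := lmod_cat A) f q ->
  is_cokernel (C := lmod_cat A) (mtensm ab D f (lmod_id P)) (mtensm ab D q (lmod_id P)).
Proof.
move=> /val_cokernel cq; have eq := cok_epi cq; apply: cokernel_val.
have cqP := tensl_coker D P cq.
have ep N := @mproj_epi K C ab c A N P.
apply: cokerI.
- apply: epiP => W w e; apply: (epi0 (ep Q)); apply: (epi0 (cok_epi cqP)).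
  by rewrite -compA -(mtensmE ab D q (lmod_id P)) compA e comp0m.
- apply: (ep L); rewrite comp0m -compA mtensmE (compr2 (mtensmE _ _ _ _)).
  by rewrite cqP.1 compm0.
move=> W t tf; have [|h hE] := coker_lift (g := t ∘ mproj ab M P) cqP.
  by rewrite -compA -(mtensmE ab D f (lmod_id P)) compA tf comp0m.
have [|h' /eqP h'E] := cok_ex (h := h) (mprojP ab Q P).
  apply: (tlepi (Z := P) (tlepi (Z := A) eq)); rewrite -!compA whr.
  rewrite -(ract_hom (lmod_homP q)) -whr compA -hE -compA mprojE.
  rewrite asc_whr -(compr2 (xch _ _)) (compr2 (esym hE)).
  by [].
exists h'; apply: (ep M).
by rewrite hE -h'E -!compA -(mtensmE ab D q (lmod_id P)).
Qed.

Lemma mtensm_rexr P L M Q (f : lmod_hom L M) (q : lmod_hom M Q) :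
  is_cokernel (C := lmod_cat A) f q ->
  is_cokernel (C := lmod_cat A) (mtensm ab D (lmod_id P) f) (mtensm ab D (lmod_id P) q).
Proof.
move=> /val_cokernel cq; have eq := cok_epi cq; apply: cokernel_val.
have cqP := tensr_coker D c P cq.
have ep N := @mproj_epi K C ab c A P N.
apply: cokerI.
- apply: epiP => W w e; apply: (epi0 (ep Q)); apply: (epi0 (cok_epi cqP)).
  by rewrite -compA -(mtensmE ab D (lmod_id P) q) compA e comp0m.
- apply: (ep L); rewrite comp0m -compA mtensmE (compr2 (mtensmE _ _ _ _)).
  by rewrite cqP.1 compm0.
move=> W t tf; have [|h hE] := coker_lift (g := t ∘ mproj ab P M) cqP.
  by rewrite -compA -(mtensmE ab D (lmod_id P) f) compA tf comp0m.
have [|h' /eqP h'E] := cok_ex (h := h) (mprojP ab P Q).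
  apply: (trepi (Z := P ⊗ A) eq); rewrite -!compA xch compA -hE -compA mprojE.
  rewrite asc_whl (compr1 (whl _ _ _)) -(lmod_homP q) -whl -compA (compA h) -hE.
  by rewrite -!compA.
exists h'; apply: (ep M).
by rewrite hE -h'E -!compA -(mtensmE ab D (lmod_id P) q).
Qed.

Section AllDualizable.
Notation CA := (lmod_moncat ab D A).
Hypothesis rigid_loc : rigid (loc_moncat ab D A).
Hypothesis simple_local : forall M : CA, simple M -> local M.

Lemma local_dualizable M : local M ->
  exists N, local N /\ left_dual (C := CA) M N.
Proof.
move=> lM; have [[[N lN] d] _] := rigid_loc (exist _ M lM).
by exists N; split=> //; exact: d.
Qed.

Lemma zero_lmodP M : zero_object (C := lmod_cat A) M <-> zero_object (M : C).
Proof.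
split=> /zero_objectP e; apply/zero_objectP; first by have := congr1 val e.
exact/lmod_inj.
Qed.

Lemma iso_lmod M N (f : lmod_hom M N) : iso (vsval f) -> iso (C := lmod_cat A) f.
Proof.
move=> [g [gf fg]]; exists (lmod_mk (inv_hom gf fg (lmod_homP f))).
by split; apply: lmod_inj.
Qed.

(** A nonzero module that is not simple has a nonzero proper submodule, whose
    length as an object of the base category is smaller. *)
Lemma simple_submodule n M : has_length n (M : C) -> ~ zero_object (M : C) ->
  exists (S : CA) (s : Mor (C := CA) S M), simple S /\ mono s.
Proof.
elim/ltn_ind: n M => n ih M ln M0.
have [sM|nsM] := classic (simple (C := lmod_cat A) M).
  by exists M, (lmod_id M); split=> // W g h; rewrite /= !lmod_comp1m.
have [S [s [ms [S0 ns]]]] : exists (S : lmod) (s : lmod_hom S M),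
    mono (C := lmod_cat A) s /\ (~ zero_object (S : C) /\ ~ iso (C := lmod_cat A) s).
  apply: NNPP => nex; apply: nsM; split=> [/zero_lmodP // | S s ms].
  apply: NNPP => /not_or_and [z i]; apply: nex; exists S, s; split=> //; split=> //.
  by move=> /zero_lmodP.
have [Q [q [cq _]]] := lmod_cokernel s.
have sq := val_ses (mono_ses lmod_abelian ms cq).
have [a [b [la lb abn]]] := has_length_ses ab ln sq.
have b0 : (0 < b)%N.
  apply: (has_length_pos lb) => Q0; apply: ns; apply: iso_lmod.
  exact: (ses_zero_quotient ab sq Q0).
have [|T [t [sT mt]]] := ih a _ _ la S0; first by rewrite -abn -addn1 leq_add2l.
by exists T, (lmod_comp s t); split=> //; exact: (mono_comp (C := lmod_cat A)).
Qed.

(** The induction splits off a simple submodule [S], not a simple quotient: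
    [S] is local, so its dual [L'] is local and has a left dual itself, which is
    how [L' ⊗_A -] is known to preserve monomorphisms. *)
Lemma all_dualizable M : (exists n, has_length n (M : C)) ->
  exists N, left_dual (C := CA) M N.
Proof.
case=> n; elim/ltn_ind: n M => n ih M ln.
have [M0|M0] := classic (zero_object (M : C)).
  by exists M; apply/zero_left_dual/zero_lmodP.
have [S [s [sS ms]]] := simple_submodule ln M0.
have [Q [q [cq _]]] := lmod_cokernel s.
have sq := mono_ses lmod_abelian ms cq.
have [a [b [la lb abn]]] := has_length_ses ab ln (val_ses sq).
have a0 : (0 < a)%N by apply: (has_length_pos la) => /zero_lmodP; exact: sS.1.
have [|R' [evR [coR dR]]] := ih b _ _ lb; first by rewrite -abn -add1n leq_add2r.
have [L' [lL' [evL [coL dL]]]] := local_dualizable (simple_local sS).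
have [L2 [_ d2]] := local_dualizable lL'.
exact: (left_dual_extension (C := CA) lmod_abelian
  (fun P L M Q => @mtensm_rexl P L M Q) (fun P L M Q => @mtensm_rexr P L M Q) sq dL dR
  (fun U V m => tens_dual_mono (C := CA) d2)).
Qed.

End AllDualizable.

End ModuleCategory.

(** * Free modules *)

Section FreeModules.
Variables (K : fieldType) (C : moncat K) (ab : abelian C) (c : braiding C).
Variables (D : r_structure C) (A : comm_algebra c).
Notation lmod := (lmod A).
Notation CA := (lmod_moncat ab D A).
Notation F := (indmod A).
Notation mtens := (mtens ab D).
Implicit Types (X Y Z W : C) (M N P Q : lmod).

Let trepi X Y Z (q : Mor X Y) : epi q -> epi (idm Z ⊗ₘ q) := @tensr_epi K C ab c D X Y Z q.

(* Locked, so that rewriting with associativity does not unfold it; likewise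
   for the locked definitions below. *)
Fact funit_key : unit. Proof. by []. Qed.
Definition funit X : Mor X (A ⊗ X) :=
  locked_with funit_key ((aone A ⊗ₘ idm X) ∘ luni X).

Lemma funitE X : funit X = (aone A ⊗ₘ idm X) ∘ luni X.
Proof. by rewrite /funit unlock. Qed.

Lemma funit_nat X Y (f : Mor X Y) : funit Y ∘ f = (idm A ⊗ₘ f) ∘ funit X.
Proof. by rewrite !funitE -compA luni_nat (compr2 (xch _ _)). Qed.

Lemma indact_funit X : indact A X ∘ (idm A ⊗ₘ funit X) = idm (A ⊗ X).
Proof.
rewrite funitE -whl /indact -!compA -(compr2 (asci_nat _ _ _)) (compr1 (whr _ _ _)).
by rewrite amul1r (compr1 (unit_coh _ _)) whl luniK tensm1.
Qed.

Fact tmod_act_key : unit. Proof. by []. Qed.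
Definition tmod_act M X : Mor (A ⊗ (M ⊗ X)) (M ⊗ X) :=
  locked_with tmod_act_key ((mact M ⊗ₘ idm X) ∘ asci A M X).

Lemma tmod_actE M X : tmod_act M X = (mact M ⊗ₘ idm X) ∘ asci A M X.
Proof. by rewrite /tmod_act unlock. Qed.

Lemma tmod_actA M X : tmod_act M X ∘ (amul A ⊗ₘ idm (M ⊗ X))
  = tmod_act M X ∘ (idm A ⊗ₘ tmod_act M X) ∘ asc A A (M ⊗ X).
Proof.
rewrite !tmod_actE -!compA asci_whr (compr1 (whr _ _ _)) mactA -!whr -whl -!compA.
by rewrite (compr2 (esym (asci_nat _ _ _))) pentE.
Qed.

Lemma tmod_act1 M X : tmod_act M X ∘ (aone A ⊗ₘ idm (M ⊗ X)) = lun (M ⊗ X).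
Proof.
rewrite !tmod_actE -compA asci_whr (compr1 (whr _ _ _)) mact1.
by rewrite -lun_asc -compA asciK compm1.
Qed.

Definition tmod M X : lmod := Lmod (tmod_actA M X) (tmod_act1 M X).

(** [M ⊗ X], with [A] acting on [M], is isomorphic to [M ⊗_A F(X)]: every element
    of [A ⊗ X] is a multiple of one of [X], and the scalar can be passed to [M]. *)
Fact tens_free_key : unit. Proof. by []. Qed.
Definition tens_free M X : Mor (M ⊗ X) (mtens_ob ab M (F X)) :=
  locked_with tens_free_key (mproj ab M (F X) ∘ (idm M ⊗ₘ funit X)).

Lemma tens_freeE M X : tens_free M X = mproj ab M (F X) ∘ (idm M ⊗ₘ funit X).
Proof. by rewrite /tens_free unlock. Qed.

Lemma tens_freei_ex M X : exists s : Mor (mtens_ob ab M (F X)) (M ⊗ X),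
  s ∘ mproj ab M (F X) == (ract M ⊗ₘ idm X) ∘ asci M A X.
Proof.
apply: (cok_ex (mprojP ab M (F X))); rewrite /bal2 /= /indact -whl -!compA.
rewrite asci_whr -(compr2 (asci_nat _ _ _)) -pentE !(compr1 (whr _ _ _)).
by rewrite ractA -!compA ascK compm1.
Qed.

Definition tens_freei M X := xchoose (tens_freei_ex M X).

Lemma tens_freeiE M X : tens_freei M X ∘ mproj ab M (F X) = (ract M ⊗ₘ idm X) ∘ asci M A X.
Proof. exact/eqP/(xchooseP (tens_freei_ex M X)). Qed.

Lemma tens_freeK M X : tens_freei M X ∘ tens_free M X = idm (M ⊗ X).
Proof.
rewrite tens_freeE (compr2 (tens_freeiE M X)) funitE -whl -(compr2 (asci_nat _ _ _)).
by rewrite (compr1 (whr _ _ _)) ract1 (compr1 (unit_coh _ _)) whl luniK tensm1.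
Qed.

Lemma tens_freeiK M X : tens_free M X ∘ tens_freei M X = idm (mtens_ob ab M (F X)).
Proof.
apply: (@mproj_epi K C ab c A M (F X)).
rewrite -compA tens_freeiE tens_freeE -compA -(compr2 (xch _ _)) (compr23 (mprojE _ _ _)).
rewrite (compr2 (asc_whl _ _ _)) (compr1 (whl _ _ _)) indact_funit tensm1.
by rewrite asciK !comp1m compm1.
Qed.

Lemma tens_freei_hom M X : tens_freei M X ∘ mact (mtens M (F X))
  = mact (tmod M X) ∘ (idm A ⊗ₘ tens_freei M X).
Proof.
apply: (trepi (Z := A) (@mproj_epi K C ab c A M (F X))).
rewrite -!compA whl tens_freeiE mtens_actE (compr2 (tens_freeiE M X)) /= tmod_actE -whl.
rewrite -!compA (compr2 (asci_whr _ _ _)) -(compr2 (asci_nat _ _ _)).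
by rewrite !(compr1 (whr _ _ _)) pentF (compr1 (whr _ _ _)) lractAi -!compA.
Qed.

Lemma tens_free_hom M X : tens_free M X ∘ mact (tmod M X)
  = mact (mtens M (F X)) ∘ (idm A ⊗ₘ tens_free M X).
Proof. 
exact: (@inv_hom _ _ _ _ (mtens M (F X)) (tmod M X) _ _
  (tens_freeiK M X) (tens_freeK M X) (tens_freei_hom M X)). Qed.

Lemma free_ext_hom V M (f : Mor V M) : (mact M ∘ (idm A ⊗ₘ f)) ∘ mact (F V)
  = mact M ∘ (idm A ⊗ₘ (mact M ∘ (idm A ⊗ₘ f))).
Proof.
rewrite /= /indact -whl (compr2 (mactAi M)) -!compA asci_whl.
by rewrite -(compr2 (xch _ _)).
Qed.

Definition free_ext V M (f : Mor V M) : lmod_hom (F V) M :=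
  @lmod_mk _ _ _ (F V) M _ (free_ext_hom f).

Lemma free_extE V M (f : Mor V M) : vsval (free_ext f) ∘ funit V = f.
Proof.
rewrite /= -compA -funit_nat funitE -compA (compr1 (mact1 M)) luni_nat.
by rewrite -luni_nat (comprK (luniK _)).
Qed.

Lemma free2_asc_hom W X : asc A W X ∘ mact (tmod (F W) X)
  = mact (F (W ⊗ X)) ∘ (idm A ⊗ₘ asc A W X).
Proof.
rewrite /= tmod_actE /= /indact -whr -!compA (compr2 (asc_whr _ _ _)).
by rewrite (compr23 (pentD _ _ _ _)) asciK compm1.
Qed.

(** The universal morphism exhibiting [F(W) ⊗_A F(X)] as the free module on
    [W ⊗ X], by [free2_ext] and [free2_inj]. *)
Definition free2 W X : Mor (W ⊗ X) (mtens_ob ab (F W) (F X)) :=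
  mproj ab (F W) (F X) ∘ (funit W ⊗ₘ funit X).

Lemma free2_ext W X M (f : Mor (W ⊗ X) M) :
  exists k : lmod_hom (mtens (F W) (F X)) M, vsval k ∘ free2 W X = f.
Proof.
pose r : lmod_hom (mtens (F W) (F X)) (tmod (F W) X) :=
  @lmod_mk _ _ _ (mtens (F W) (F X)) (tmod (F W) X) _ (tens_freei_hom (F W) X).
pose s : lmod_hom (tmod (F W) X) (F (W ⊗ X)) :=
  @lmod_mk _ _ _ (tmod (F W) X) (F (W ⊗ X)) _ (free2_asc_hom W X).
exists (lmod_comp (free_ext f) (lmod_comp s r)).
have e : vsval r ∘ free2 W X = funit W ⊗ₘ idm X.
  rewrite [vsval r]/(tens_freei (F W) X).
  by rewrite /free2 -(trl (funit W) (funit X)) (compA (mproj _ _ _)) -(tens_freeE (F W) X)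
    (comprK (tens_freeK (F W) X)).
rewrite !val_lmod_comp -!compA e.
rewrite -[RHS](free_extE f) /= -compA; congr (_ ∘ _ ∘ _).
by rewrite !funitE -whr (compr2 (asc_whr _ _ _)) asc_luni.
Qed.

Lemma free2_inj W X M (k k' : lmod_hom (mtens (F W) (F X)) M) :
  vsval k ∘ free2 W X = vsval k' ∘ free2 W X -> k = k'.
Proof.
have e (l : lmod_hom (mtens (F W) (F X)) M) : vsval l
    = mact M ∘ (idm A ⊗ₘ (vsval l ∘ free2 W X)) ∘ asc A W X ∘ tens_freei (F W) X.
  have gen : tmod_act (F W) X ∘ (idm A ⊗ₘ (funit W ⊗ₘ idm X)) ∘ asc A W X = idm _.
    rewrite -asc_nat tmod_actE -compA (comprK (ascK _ _ _)) whr indact_funit tensm1 //.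
  rewrite -[LHS]compm1 -(tens_freeiK (F W) X).
  rewrite -[in LHS](comp1m (tens_freei _ _)) -gen -!compA. rewrite (compr2 (tens_free_hom (F W) X)).
  rewrite (compr2 (lmod_homP l)) !(compr1 (whl _ _ _)) tens_freeE -!compA trl.
  by [].
by move=> kk'; apply: lmod_inj; rewrite e [RHS]e kk'.
Qed.

Section DualPair.
Variables (X X' : C) (ev : Mor (X' ⊗ X) (munit C)).
Variable g : lmod_hom (mtens (F X') (F X)) (regmod A).
Hypothesis gE : vsval g ∘ free2 X' X = aone A ∘ ev.

(** The contraction against [F(ev)] restricts to the one against [ev]. *)
Lemma contract_free Z M N (H : lmod_hom N (mtens M (F X'))) (h : Mor Z (M ⊗ X'))
    (n : Mor Z N) :
  vsval H ∘ n = tens_free M X' ∘ h ->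
  vsval (contract (C := CA) g H) ∘ mproj ab N (F X) ∘ (n ⊗ₘ funit X) = contract ev h.
Proof.
move=> e; rewrite !contractE !val_lmod_comp -!compA.
rewrite (compr2 (mtensmE ab D H (lmod_id (F X)))) -tensmM val_lmod_id comp1m e.
rewrite tens_freeE -compA.
have -> : (mproj ab M (F X') ∘ (idm M ⊗ₘ funit X') ∘ h) ⊗ₘ funit X
  = (mproj ab M (F X') ⊗ₘ idm _) ∘ (idm M ⊗ₘ funit X' ⊗ₘ funit X) ∘ (h ⊗ₘ idm X).
  by rewrite -!tensmM !compm1 !comp1m.
rewrite (compr3 (mascE ab D M (F X') (F X))) -!compA.
rewrite (compr2 (mtensmE ab D (lmod_id M) g)) (compr1 (mrunE ab D M)).
rewrite (compr2 (asc_nat _ _ _)) !(compr1 (whl _ _ _)).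
have gE' : vsval g ∘ mproj ab (F X') (F X) ∘ (funit X' ⊗ₘ funit X) = aone A ∘ ev.
  exact: gE.
by rewrite -compA gE' -whl -!compA (compr1 (ract1 M)).
Qed.

Variables (N : lmod) (evN : Mor (C := CA) (mtens N (F X)) (munit CA)).
Variables (coN : Mor (C := CA) (munit CA) (mtens (F X) N)).
Hypothesis dN : duality (C := CA) evN coN.
Variable phi : lmod_hom (F X') N.
Hypothesis iphi : iso (C := lmod_cat A) phi.
Hypothesis gphi : g = lmod_comp evN (mtensm ab D phi (lmod_id (F X))).

Lemma contract_phi M P (H : lmod_hom P (mtens M (F X'))) :
  contract (C := CA) g H = contract (C := CA) evN (lmod_comp (mtensm ab D (lmod_id M) phi) H).
Proof. by rewrite gphi; apply: esym; exact: (contract_mid (C := CA)). Qed.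

(** Injectivity of the contraction with the evaluation [evN] of modules, seen on
    the generators [Z] of [F(Z)]. *)
Lemma contract_ev_inj Z M (h h' : Mor Z (M ⊗ X')) : contract ev h = contract ev h' -> h = h'.
Proof.
pose H (k : Mor Z (M ⊗ X')) : lmod_hom (F Z) (mtens M (F X')) :=
  @free_ext Z (mtens M (F X')) (tens_free M X' ∘ k).
have HE k : vsval (H k) ∘ funit Z = tens_free M X' ∘ k.
  exact: (@free_extE Z (mtens M (F X')) (tens_free M X' ∘ k)).
move=> e; have : H h = H h'.
  have [psi [psiphi phipsi]] := iphi.
  have : contract (C := CA) g (H h) = contract (C := CA) g (H h').
    apply: free2_inj; rewrite /free2 (contract_free (HE h)).
    by rewrite (contract_free (HE h')).
  rewrite !contract_phi => /(contract_inj dN) /(congr1 (lmod_comp (mtensm ab D (lmod_id M) psi))).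
  rewrite !lmod_compA -(mtensmM ab D (lmod_id M) (lmod_id M)) lmod_comp1m.
  rewrite [lmod_comp psi phi]psiphi mtensm1 !lmod_comp1m //.
move=> /(congr1 (fun u : lmod_hom (F Z) (mtens M (F X')) => vsval u ∘ funit Z)).
rewrite !HE => /(congr1 (fun u => tens_freei M X' ∘ u)).
by rewrite !(comprK (tens_freeK M X')).
Qed.

(** The coevaluation of modules, restricted to the unit of [A]. *)
Lemma contract_ev_coev : exists i : Mor (munit C) (A ⊗ X ⊗ X'), contract ev i = funit X ∘ lun X.
Proof.
have [psi [psiphi phipsi]] := iphi.
pose H : lmod_hom (regmod A) (mtens (F X) (F X')) :=
  lmod_comp (mtensm ab D (lmod_id (F X)) psi) (curry (C := CA) coN (mlun ab D (F X))).
have HE : contract (C := CA) g H = mlun ab D (F X).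
  rewrite contract_phi /H lmod_compA -(mtensmM ab D (lmod_id (F X)) (lmod_id (F X))).
  rewrite lmod_comp1m [lmod_comp phi psi]phipsi mtensm1 lmod_comp1m.
  exact: (curryK (C := CA) dN).
pose i := tens_freei (F X) X' ∘ vsval H ∘ aone A.
have iE : vsval H ∘ aone A = tens_free (F X) X' ∘ i.
  by rewrite /i (comprK (tens_freeiK (F X) X')).
exists i; rewrite -(contract_free iE) HE (compr1 (mlunE ab D (F X))) /=.
rewrite -(tlr (aone A)) (compr1 (indact1 A X)).
by rewrite lun_nat.
Qed.

End DualPair.

(** The comparison [phi : F(X') -> N] with the dual [N] of [F(X)] is the one under
    which [evN] restricts to the [A]-linear extension [g] of [ev]. It is nonzero,
    and so invertible by assumption, because [A] contains the unit object and
    [ev] is epi. *)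
Lemma simple_free_pairing X X' (ev : Mor (X' ⊗ X) (munit C)) :
  epi ev -> ~ zero_object X -> mono (aone A) ->
  (exists N, left_dual (C := CA) (F X) N) ->
  (forall N, left_dual (C := CA) (F X) N ->
    forall f : Mor (C := CA) (F X') N, f <> 0 -> iso f) ->
  (forall Z M (h h' : Mor Z (M ⊗ X')), contract ev h = contract ev h' -> h = h') /\
  exists i : Mor (munit C) (A ⊗ X ⊗ X'), contract ev i = funit X ∘ lun X.
Proof.
move=> eev X0 mi [N [evN [coN dN]]] isoN.
have [g gE] := @free2_ext X' X (regmod A) (aone A ∘ ev).
pose phi : lmod_hom (F X') N := lmod_comp (mlun ab D N) (curry (C := CA) coN g).
have gphi : g = lmod_comp evN (mtensm ab D phi (lmod_id (F X))).
  have luniphi : lmod_comp (mluni ab D N) phi = curry (C := CA) coN g.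
    exact: (comprK (lunK (C := CA) N)).
  rewrite -[LHS](curryK (C := CA) dN) -luniphi.
  exact: (contract_luni (C := CA)).
have iphi : iso (C := lmod_cat A) phi.
  apply: (isoN N); first by exists evN, coN.
  move=> phi0; apply/X0/zero_objectP.
  have ev0 : ev = 0.
    apply: (mono0 mi); rewrite -gE gphi phi0.
    have -> : mtensm ab D (0 : lmod_hom (F X') N) (lmod_id (F X)) = 0.
      exact: (tens0m (C := CA)).
    by rewrite [lmod_comp _ _](compm0 (C := CA)) comp0m.
  have u0 : idm (munit C) = 0.
    by apply: (epi0 eev); rewrite ev0 compm0.
  by rewrite -(luniK X) -[lun X]compm1 -tensm1 u0 tens0m compm0 comp0m.
split; last exact: (contract_ev_coev gE dN iphi gphi).
by move=> Z M h h'; exact: (contract_ev_inj gE dN iphi gphi).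
Qed.

End FreeModules.

(** * Dualizing functors *)

Section Equivalences.
Variables (K : fieldType) (C C' : lincat K) (F : functor C C').

Lemma left_inverse_faithful (G : functor C' C) u :
  natural_iso (F := compfun G F) (G := idfun_cat C) u ->
  forall X Y (f f' : Mor X Y), fmor F f = fmor F f' -> f = f'.
Proof.
move=> [ui un] X Y f f' e; apply: (iso_epi (ui X)).
by rewrite -[LHS]un -[RHS]un /= e.
Qed.

Lemma equivalence_ff : equivalence F ->
  (forall X Y (f f' : Mor X Y), fmor F f = fmor F f' -> f = f') /\
  forall X Y (g : Mor (F X) (F Y)), exists f, fmor F f = g.
Proof.
move=> [G [[u uP] [v vP]]]; split=> [X Y f f' | X Y g].
  exact: (left_inverse_faithful uP).
have [w [wu uw]] := uP.1 X.
exists (u Y ∘ fmor G g ∘ w).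
have Gfaith X' Y' (h h' : Mor X' Y') : fmor G h = fmor G h' -> h = h'.
  move=> e; apply: (iso_epi (vP.1 X')).
  by rewrite -[LHS](vP.2 _ _ h) -[RHS](vP.2 _ _ h') /= e.
apply: Gfaith; apply: (iso_mono (uP.1 Y)).
have := uP.2 _ _ (u Y ∘ fmor G g ∘ w); rewrite /= => ->.
by rewrite -!compA wu compm1.
Qed.
End Equivalences.

Section RCategory.
Variables (K : fieldType) (C : moncat K) (D : r_structure C).
Implicit Types X Y Z W : C.

Lemma dmor_inj X Y (f f' : Mor X Y) : dmor D f = dmor D f' -> f = f'.
Proof. exact: ((equivalence_ff (dfun_equiv D)).1 Y X f f'). Qed.

Lemma dmor_full X Y (g : Mor (dob D Y) (dob D X)) : exists f : Mor X Y, dmor D f = g.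
Proof. exact: ((equivalence_ff (dfun_equiv D)).2 Y X g). Qed.

(** By the universal property of [dev] the hypothesis says [D f = D f'], and [D] is
    faithful. *)
Lemma dev_injr X W (f f' : Mor W X) :
  dev D X ∘ (idm _ ⊗ₘ f) = dev D X ∘ (idm _ ⊗ₘ f') -> f = f'.
Proof. by move=> e; apply/dmor_inj/dev_inj; rewrite !dmorE. Qed.

Lemma left_dual_iso X Y Y' (psi : Mor Y' Y) : iso psi -> left_dual X Y -> left_dual X Y'.
Proof.
move=> [psi' [k k']] [ev [coev d]].
exists (ev ∘ (psi ⊗ₘ idm X)), ((idm X ⊗ₘ psi') ∘ coev); apply: dualityI.
  move=> h h'; rewrite -!contract_mid => /(contract_inj d) e.
  have kk : (idm (munit C) ⊗ₘ psi') ∘ (idm _ ⊗ₘ psi) = idm _ by rewrite whl k tensm1.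
  by rewrite -[h](comprK kk) e (comprK kk).
by rewrite -contract_mid (compr1 (whl _ _ _)) k' tensm1 comp1m (contract_coev d).
Qed.

(** [D X] and a left dual of [X] represent the same functor [Hom(- ⊗ X, 1)]. *)
Lemma left_dual_dob X : (exists Y, left_dual X Y) -> left_dual X (dob D X).
Proof.
move=> [Y [ev [coev d]]].
pose a : Mor Y (dob D X) := dfact D ev.
pose b : Mor (dob D X) Y := lun Y ∘ curry coev (dev D X).
have bE : ev ∘ (b ⊗ₘ idm X) = dev D X.
  by rewrite -contract_luni (comprK (lunK _)) (curryK d).
have aE : dev D X ∘ (a ⊗ₘ idm X) = ev by exact: dfactK.
apply: (left_dual_iso (psi := b)); last by exists ev, coev.
exists a; split; first by apply: dev_inj; rewrite -whr (compr1 aE) bE tensm1 compm1.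
apply/luni_inj/(contract_inj d).
by rewrite !contract_luni -whr (compr1 bE) aE tensm1 compm1.
Qed.

(** [D] is essentially surjective, so every object is isomorphic to some [D Z],
    and thereby to the left dual of [Z]. *)
Lemma rigid_of_left_duals : (forall X, exists Y, left_dual X Y) -> rigid C.
Proof.
move=> ld X; split=> //.
have [G [_ [v [vi _]]]] := dfun_equiv D.
have [v' [v'v vv']] := vi X.
exists (G X : C); apply: (left_dual_iso (psi := (v' : Mor X (dob D (G X))))).
  by exists (v X).
exact: left_dual_dob.
Qed.

End RCategory.

(** The mirror image of [run_br], from the hexagon that moves [X] past two copies
    of the unit object. *)
Lemma lun_br (K : fieldType) (C : moncat K) (c : braiding C) (X : C) :
  lun X ∘ c X (munit C) = run X.
Proof.
apply: tensr1_inj; set v := lun X ∘ _.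
have vi : (bri c X (munit C) ∘ luni X) ∘ v = idm (X ⊗ munit C).
  by rewrite -compA (comprK (lunK X)) brK.
apply: (iso_mono (X := X ⊗ munit C) (f := v)).
  exists (bri c X (munit C) ∘ luni X); split=> //.
  by rewrite /v -!compA (comprK (briK _ _ _)) luniK.
rewrite -run_tens1 -[RHS]/(v ∘ run (X ⊗ munit C)).
have -> : v ∘ (v ⊗ₘ idm (munit C)) = lun X ∘ (idm _ ⊗ₘ lun X) ∘
    (idm _ ⊗ₘ c X (munit C)) ∘ asc _ X _ ∘ (c X (munit C) ⊗ₘ idm (munit C)).
  rewrite (compr1 (whl _ _ _)) -/v (compr2 (lun_nat v)) (compr1 (lun_asc _ _)).
  by rewrite whr.
rewrite -br_hexr (compr1 (triangle _ _)) -(compr2 (br_nat c _ _)).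
by rewrite /v -!compA run_asc.
Qed.

(** * Coevaluations of simple objects *)

Section Simple.
Variables (K : fieldType) (C : moncat K) (ab : abelian C) (c : braiding C).
Variables (D : r_structure C) (A : comm_algebra c).
Hypothesis hiota : mono (aone A).
Hypothesis hc : forall (S : C) (s : Mor S A), mono s ->
  (forall f : Mor S (munit C), s <> aone A ∘ f) ->
  exists Z : C, c Z S <> bri c S Z /\ mono (s ⊗ₘ idm Z).
Notation funit := (funit A).
Implicit Types X Y Z W : C.

Lemma run_funit : run A ∘ funit (munit C) = aone A.
Proof. by rewrite funitE (compr2 (run_nat _)) run1 luniK compm1. Qed.

Lemma asc_funit X Y : asc A X Y ∘ (funit X ⊗ₘ idm Y) = funit (X ⊗ Y).
Proof. by rewrite !funitE -whr (compr2 (asc_whr _ _ _)) asc_luni. Qed.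

Section Coevaluation.
Variables (X X' : C) (ev : Mor (X' ⊗ X) (munit C)).
Hypothesis ev_inj : forall Z (M : lmod A) (h h' : Mor Z (M ⊗ X')),
  contract ev h = contract ev h' -> h = h'.
Variable i : Mor (munit C) (A ⊗ X ⊗ X').
Hypothesis iE : contract ev i = funit X ∘ lun X.

Definition acoev : Mor (munit C) (A ⊗ (X ⊗ X')) := asc A X X' ∘ i.

(** Here [b] stands for the braiding or the inverse braiding of [Z] with [A]. The
    point is that the contraction of [moved_coev] does not depend on [b], because
    contracting [i] leaves only the unit of [A], past which [Z] moves in one
    way. *)
Section HalfBraiding.
Variables (Z : C) (b : Mor (Z ⊗ A) (A ⊗ Z)).
Hypothesis bE : b ∘ (idm Z ⊗ₘ aone A) ∘ runi Z = funit Z.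

Definition moved_coev : Mor Z (A ⊗ (Z ⊗ X) ⊗ X') :=
  ((asc A Z X ∘ (b ⊗ₘ idm X) ∘ asci Z A X) ⊗ₘ idm X')
    ∘ asci Z (A ⊗ X) X' ∘ (idm Z ⊗ₘ i) ∘ runi Z.

Lemma contract_moved_coev : contract ev moved_coev = funit (Z ⊗ X).
Proof.
rewrite /moved_coev contract_natr (compA (asci Z _ X')) contract_natl contract_whisk iE -whl.
rewrite -!compA (compr1 (triangle _ _)).
rewrite whr runiK tensm1 compm1 [funit X]funitE -whl.
rewrite -(compr2 (asci_nat _ _ _)) asci_luni !(compr1 (whr _ _ _)) !whr.
by rewrite -!compA bE asc_funit.
Qed.

Lemma acoev_moved : (b ⊗ₘ idm (X ⊗ X')) ∘ asci Z A (X ⊗ X') ∘ (idm Z ⊗ₘ acoev)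
    ∘ runi Z = asc (A ⊗ Z) X X' ∘ (asci A Z X ⊗ₘ idm X') ∘ moved_coev.
Proof.
rewrite /moved_coev /acoev (compr1 (whr _ _ _)) (comprK (ascK _ _ _)).
rewrite -whr -!compA (compr2 (asc_whr _ _ _)) (compr23 (pentD _ _ _ _)).
by rewrite (comprK (asciK _ _ _)) (compr1 (whl _ _ _)).
Qed.

End HalfBraiding.

(** The two sides are [moved_coev] for the braiding and for its inverse, up to
    associators, and [ev_inj] applies to their common contraction. *)
Lemma acoev_transparent Z :
  (c Z A ⊗ₘ idm (X ⊗ X')) ∘ asci Z A (X ⊗ X') ∘ (idm Z ⊗ₘ acoev)
  = (bri c A Z ⊗ₘ idm (X ⊗ X')) ∘ asci Z A (X ⊗ X') ∘ (idm Z ⊗ₘ acoev).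
Proof.
have er : epi (runi Z) by apply: epi_inv; exact: runK.
apply: er; rewrite -!compA !acoev_moved; congr (_ ∘ _ ∘ _).
apply: (@ev_inj _ (indmod A (Z ⊗ X))); rewrite !contract_moved_coev // funitE.
  rewrite (compr2 (bri_nat _ _ _)); congr (_ ∘ _).
  by rewrite -[LHS](comprK (lunK Z)) (compr1 (lun_bri _ _)) runiK compm1.
rewrite (compr2 (br_nat _ _ _)); congr (_ ∘ _).
by rewrite -[LHS](comprK (lunK Z)) (compr1 (lun_br _ _)) runiK compm1.
Qed.

(** Let [S] be the image of the contraction of [acoev] with [de]. By
    [acoev_transparent] the two braidings of [Z] with [S] agree in [A ⊗ Z], hence
    agree whenever [S ⊗ Z -> A ⊗ Z] is mono; by [hc] this is impossible for all
    [Z] unless [S] lies in the unit object. *)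
Lemma trace_in_unit B (de : Mor (X ⊗ X' ⊗ B) (munit C)) :
  exists j : Mor (munit C ⊗ B) (munit C), contract de acoev = aone A ∘ j.
Proof.
have [S [s [t [ms et st]]]] := image_fact ab (contract de acoev).
have [[f sf]|nf] := classic (exists f, s = aone A ∘ f).
  by exists (f ∘ t); rewrite st sf compA.
have [|Z [cZ mZ]] := hc ms; first by move=> f sf; apply: nf; exists f.
case: cZ; apply: mZ; rewrite -br_nat -bri_nat.
apply: (tensr_epi ab c D (Z := Z) et).
rewrite -!compA whl -st.
have ea : epi (asc Z (munit C) B) by apply: epi_inv; exact: asciK.
apply: ea; rewrite -!compA -contract_whisk -!contract_natr.
by rewrite acoev_transparent.
Qed.

Variable ev_injr : forall W (f f' : Mor W X),
  ev ∘ (idm X' ⊗ₘ f) = ev ∘ (idm X' ⊗ₘ f') -> f = f'.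
Variable ev_injl : forall W (f f' : Mor W X'),
  ev ∘ (f ⊗ₘ idm X) = ev ∘ (f' ⊗ₘ idm X) -> f = f'.

(** For [t : 1 -> X ⊗ X'], the composite of [t ⊗ X] with [snake] is the zigzag on
    [X]; [nested_ev] pairs that zigzag further with [X']. Thus the pairing of [t] with
    [X ⊗ X'] by [nested_ev] detects the zigzag, while being a functional in the sense
    of [trace_in_unit]. *)
Definition snake : Mor (X ⊗ X' ⊗ X) X := run X ∘ (idm X ⊗ₘ ev) ∘ asc X X' X.
Definition nested_ev : Mor (X ⊗ X' ⊗ (X ⊗ X')) (munit C) :=
  ev ∘ c X X' ∘ (snake ⊗ₘ idm X') ∘ asci (X ⊗ X') X X'.

Lemma snake_acoev : (idm A ⊗ₘ snake) ∘ asc A (X ⊗ X') X ∘ (acoev ⊗ₘ idm X)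
  = funit X ∘ lun X.
Proof.
rewrite -iE contractE /acoev /snake -!whl -whr -!compA (compr3 (pentagon _ _ _ _)).
by rewrite -(compr2 (asc_whl _ _ _)) (compr1 (run_asc _ _)).
Qed.

Lemma contract_nested_ev : contract nested_ev acoev = aone A ∘ ev ∘ c X X' ∘ lun (X ⊗ X').
Proof.
have pent : (idm A ⊗ₘ asci (X ⊗ X') X X') ∘ asc A (X ⊗ X') (X ⊗ X')
    = asc A (X ⊗ X' ⊗ X) X' ∘ (asc A (X ⊗ X') X ⊗ₘ idm X') ∘ asci (A ⊗ (X ⊗ X')) X X'.
  by rewrite (compr23 (pentB _ _ _ _)) asciK compm1.
rewrite contractE /nested_ev -!whl -!compA (compr23 pent).
rewrite asci_whr -(compr2 (asc_nat _ _ _)) !(compr1 (whr _ _ _)).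
rewrite -compA snake_acoev.
rewrite -whr -!compA (compr1 (asc_funit _ _)) -!(compr2 (funit_nat _ _)).
rewrite -[in LHS]lun_asc -!compA asciK compm1 (compr1 run_funit).
by [].
Qed.

(** If [i0] and [acoev] have the same values under [nested_ev], then so have their
    zigzags under the pairing [ev ∘ c X X'] of [X] with [X'], after the mono
    from the unit to [A]. The zigzag of [acoev] is the unit [X -> A ⊗ X], so that
    of [i0] is the identity. *)
Lemma duality_of_nested_ev (i0 : Mor (munit C) (X ⊗ X')) :
  aone A ∘ nested_ev ∘ (i0 ⊗ₘ idm (X ⊗ X')) = contract nested_ev acoev -> duality ev i0.
Proof.
rewrite contract_nested_ev => /hiota e.
pose f := snake ∘ (i0 ⊗ₘ idm X) ∘ luni X.
have f1 : f = idm X.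
  apply: ev_injr; apply: (@br_epi _ _ c X X').
  rewrite -!compA -!br_nat tensm1 compm1.
  have er : epi (lun (X ⊗ X')) by apply: epi_inv; exact: luniK.
  apply: er; rewrite -!compA -e /nested_ev.
  have la : (luni X ⊗ₘ idm X') ∘ lun (X ⊗ X') = asci _ X X'.
    by rewrite -[LHS](comprK (ascK _ _ _)) (compr1 (asc_luni _ _)) lunK compm1.
  rewrite -!compA asci_whr (compr1 (whr _ _ _)) /f -la [in RHS](compr1 (whr _ _ _)).
  by rewrite -!compA.
apply: dualityI.
  move=> h h'; rewrite -[h](comprK (lunK X')) -[h'](comprK (lunK X')) !contract_luni.
  by move=> /ev_injl ->.
by rewrite -[RHS]comp1m -f1 contractE /f /snake -!compA lunK compm1.
Qed.

End Coevaluation.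

(** All functionals on [Y = X ⊗ X'] factor through the universal one, with values
    in [B = D Y]. Its value [j] on [acoev] lies in the unit object, and [i0] is
    the morphism dual to [j]. *)
Lemma simple_left_dual X : simple X ->
  epi (dev D X) ->
  (exists N, left_dual (C := lmod_moncat ab D A) (indmod A X) N) ->
  (forall N, left_dual (C := lmod_moncat ab D A) (indmod A X) N ->
     forall f : Mor (C := lmod_moncat ab D A) (indmod A (dob D X)) N,
       f <> 0 -> iso f) ->
  left_dual X (dob D X).
Proof.
move=> [X0 _] eev exN isoN.
have [einj [i iE]] := simple_free_pairing eev X0 hiota exN isoN.
set X' := dob D X in einj i iE *; set ev := dev D X in einj iE *.
set Y := X ⊗ X'; pose B := dob D Y.
have [j jE] := trace_in_unit einj iE (dev D Y ∘ c Y B).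
pose phi : Mor (munit C) (dob D (munit C)) := dfact D (run (munit C)).
have [i0 i0E] := dmor_full (phi ∘ j ∘ luni B).
have devi0 : dev D Y ∘ (idm B ⊗ₘ i0) = j ∘ luni B ∘ run B.
  rewrite -dmorE i0E -whr (compr1 (dfactK D _)) run_nat -compA.
  by [].
have dei0 : dev D Y ∘ c Y B ∘ (i0 ⊗ₘ idm B) = j.
  by rewrite br_nat (compr1 devi0) -!compA run_br lunK compm1.
pose w : Mor Y B := dfact D (nested_ev ev ∘ bri c Y Y).
have wE : (dev D Y ∘ c Y B) ∘ (idm Y ⊗ₘ w) = nested_ev ev.
  by rewrite -compA br_nat (compr1 (dfactK D _)) -compA brK compm1.
exists ev, i0; apply: (duality_of_nested_ev (i := i) iE).
- by move=> W f f'; exact: dev_injr.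
- by move=> W f f'; exact: dev_inj.
rewrite -wE contract_right jE -!compA -xch.
by rewrite -[in RHS]dei0 -!compA.
Qed.

End Simple.

(** The dual [Y'] of the subobject is flat on the left: [- ⊗ Y'] has the left
    adjoint [- ⊗ Y], and the braiding exchanges [- ⊗ Y'] with [Y' ⊗ -]. *)
Lemma left_dual_finite_length (K : fieldType) (C : moncat K) (ab : abelian C)
    (c : braiding C) (D : r_structure C) (X : C) :
  (forall Y : C, simple Y -> exists Y', left_dual Y Y') ->
  finite_length ab X -> exists X', left_dual X X'.
Proof.
move=> sd; elim=> {X} [X X0 | X Y i _ [Y' [evY [coY dY]]] mi sQ].
  by exists X; exact: zero_left_dual.
have [Q' [evQ [coQ dQ]]] := sd _ sQ.
have iq := mono_ses ab mi (cokermP ab i).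
apply: (left_dual_extension ab (fun X _ _ _ f q => @tensl_coker K C D _ _ _ X f q)
  (fun X _ _ _ f q => @tensr_coker K C D c _ _ _ X f q) iq dY dQ).
move=> U V m mm; apply: monoP => W w e.
have e' : bri c U Y' ∘ w = 0.
  apply: (contract_inj dY); rewrite contract0; apply: (mono0 mm).
  rewrite -contract_natr.
  have -> : (m ⊗ₘ idm Y') ∘ bri c U Y' ∘ w = bri c V Y' ∘ (idm Y' ⊗ₘ m) ∘ w.
    by rewrite (compr2 (bri_nat c _ _)).
  by rewrite e compm0 contract0.
by rewrite -[w](comprK (briK c U Y')) e' compm0.
Qed.

Theorem theorem1p6 (K : fieldType) (C : moncat K) (ab : abelian C)
  (hfl : forall X : C, finite_length ab X)
  (c : braiding C) (D : r_structure C) (theta : twist c)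
  (hribbon : ribbon D theta)
  (A : comm_algebra c)
  (htheta : theta A ∘ theta A = idm A)
  (hiota : mono (aone A))
  (ha_rigid : rigid (loc_moncat ab D A))
  (ha_simple : forall M : lmod_moncat ab D A, simple M -> local M)
  (hb_epi : forall X : C, simple X -> epi (dev D X))
  (hb_iso : forall X : C, simple X ->
     forall FXd : lmod_moncat ab D A,
       left_dual (C := lmod_moncat ab D A) (indmod A X) FXd ->
       forall f : Mor (C := lmod_moncat ab D A) (indmod A (dob D X)) FXd,
         f <> 0%R -> iso f)
  (hc : forall (S : C) (s : Mor S A), mono s ->
     (forall f : Mor S (munit C), s <> aone A ∘ f) ->
     exists Z : C, c Z S <> bri c S Z /\ mono (s ⊗ₘ idm Z)) :
  rigid C.
Proof.
apply: (rigid_of_left_duals D) => X.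
apply: (left_dual_finite_length c D _ (hfl X)) => Y sY.
exists (dob D Y); apply: (simple_left_dual hiota hc sY (hb_epi Y sY)).
  by apply: all_dualizable => //; exact: (finite_length_has_length (hfl _)).
exact: hb_iso.
Qed.
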